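(* Let $G$ be a locally compact group and $K\in\mathcal{K}(G)$. (i) If $N_G(K)\supsetneq K$, then $\Gamma_{m_K}\subsetneq\mathcal{M}_{m_K}$. (ii) If $N_G(K)/K$ contains either a non-discrete closed abelian subgroup, or a closed non-Hermitian subgroup, then the connected component of the identity, $\mathcal{M}_{m_K,0}$, of $\mathcal{M}_{m_K}$ (with respect to the norm topology) is unbounded (in norm).
   Context: $\mathrm{M}(G)$ denotes the measure algebra of $G$: the complex (finite, regular) Borel measures on $G$, identified with the dual of $\mathcal{C}_0(G)$, with convolution $\ast$ as product, the total variation norm, and involution given by $\int_G u\,d\nu^*=\int_G u(s^{-1})\,d\overline{\nu}(s)$; $\delta_g$ is the point mass at $g\in G$. $\mathcal{K}(G)$ denotes the collection of all compact subgroups of $G$; for $K\in\mathcal{K}(G)$, $m_K$ is the normalised Haar measure on $K$, regarded as an element of $\mathrm{M}(G)$. $N_G(K)=\{g\in G:gKg^{-1}=K\}$. $\mathbb{T}=\{z\in\mathbb{C}:|z|=1\}$. The two groups of measures with identity $m_K$ are \[ \Gamma_{m_K}=\{z\delta_g\ast m_K: z\in\mathbb{T},\ g\in N_G(K)\} \] and the local unitary group \[ \mathcal{M}_{m_K}=\{\nu\in\mathrm{M}(G):\nu^*\ast\nu=m_K=\nu\ast\nu^*\}. \] One has $\Gamma_{m_K}\subseteq\mathcal{M}_{m_K}$. A locally compact group $H$ is called Hermitian if each self-adjoint element of the group algebra $\mathrm{L}^1(H)$ has real spectrum; non-Hermitian means not Hermitian. *)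

(* Defs.v *)
From HB Require Import structures.
From mathcomp Require Import all_boot all_order all_algebra complex.
From mathcomp Require Import all_classical all_reals topology normedtype.

Set Implicit Arguments.
Unset Strict Implicit.
Unset Printing Implicit Defensive.

Import Order.TTheory GRing.Theory Num.Theory.
Import numFieldNormedType.Exports.
Import ComplexField.Normc.

Local Open Scope quotient_scope.

Local Open Scope classical_set_scope.
Local Open Scope ring_scope.

(* The library's instances for number fields are not keyed on [complex]. *)
HB.instance Definition _ (R : realType) := GRing.ComAlgebra.copy R[i] R[i]^o.
HB.instance Definition _ (R : realType) := NormedModule.copy R[i] R[i]^o.

HB.mixin Record isTopGroup G of Topological G & Group G := {
  mulg_continuous : continuous (fun x : G * G => (x.1 * x.2)%g);
  invg_continuous : continuous (fun x : G => x^-1%g)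
}.

#[short(type="topGroupType")]
HB.structure Definition TopGroup :=
  {G of isTopGroup G & Topological G & Group G}.

Record subgroup (G : groupType) := Subgroup {
  subgroup_set :> set G;
  subgroup1 : subgroup_set 1%g;
  subgroupM : forall x y, subgroup_set x -> subgroup_set y ->
    subgroup_set (x * y)%g;
  subgroupV : forall x, subgroup_set x -> subgroup_set x^-1%g }.

(* A subgroup as a topological group: [set_type] carries the subspace
   topology. *)
Definition subgroup_type (G : topGroupType) (H : subgroup G) : Type :=
  set_type H.

Section SubgroupTopGroup.
Variables (G : topGroupType) (H : subgroup G).
Local Notation T := (subgroup_type H).

HB.instance Definition _ := Topological.copy T (set_type H).

Definition subg_val (x : T) : G := \val x.

Lemma subg_valP (x : T) : subgroup_set H (subg_val x).
Proof. by apply/set_mem; case: x. Qed.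

Definition subg_mk (x : G) (Hx : subgroup_set H x) : T := exist _ x (mem_set Hx).

Lemma subg_val_inj : injective subg_val.
Proof. exact: val_inj. Qed.

Definition subg_one : T := subg_mk (subgroup1 H).
Definition subg_mul (x y : T) : T :=
  subg_mk (subgroupM (subg_valP x) (subg_valP y)).
Definition subg_inv (x : T) : T := subg_mk (subgroupV (subg_valP x)).

Fact subg_mulA : associative subg_mul.
Proof. by move=> x y z; apply: subg_val_inj; exact: mulgA. Qed.
Fact subg_mul1 : left_id subg_one subg_mul.
Proof. by move=> x; apply: subg_val_inj; exact: mul1g. Qed.
Fact subg_1mul : right_id subg_one subg_mul.
Proof. by move=> x; apply: subg_val_inj; exact: mulg1. Qed.
Fact subg_mulV : left_inverse subg_one subg_inv subg_mul.
Proof. by move=> x; apply: subg_val_inj; exact: mulVg. Qed.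
Fact subg_Vmul : right_inverse subg_one subg_inv subg_mul.
Proof. by move=> x; apply: subg_val_inj; exact: mulgV. Qed.

HB.instance Definition _ :=
  isGroup.Build T subg_mulA subg_mul1 subg_1mul subg_mulV subg_Vmul.

Lemma subg_val_continuous : continuous subg_val.
Proof. exact: initial_continuous. Qed.

Lemma continuous_subg (S : topologicalType) (f : S -> T) :
  continuous (subg_val \o f) -> continuous f.
Proof.
move=> cf; apply/continuousP => A [B oB <-].
by move/continuousP: cf => /(_ _ oB).
Qed.

Fact subg_mulg_continuous : continuous (fun x : T * T => (x.1 * x.2)%g).
Proof.
apply: continuous_subg => -[x y].
apply: (@continuous_comp _ _ _ (fun y : T * T => (subg_val y.1, subg_val y.2))
  (fun y => y.1 * y.2)%g); last exact: mulg_continuous.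
have cv := subg_val_continuous.
apply: (@cvg_pair _ _ _ _ (nbhs (subg_val x)) (nbhs (subg_val y))).
  exact: (@cvg_comp _ _ _ fst subg_val _ _ _ cvg_fst (cv x)).
exact: (@cvg_comp _ _ _ snd subg_val _ _ _ cvg_snd (cv y)).
Qed.

Fact subg_invg_continuous : continuous (fun x : T => x^-1%g).
Proof.
apply: continuous_subg => x.
exact: (@cvg_comp _ _ _ subg_val _ _ _ _ (@subg_val_continuous x)
  (@invg_continuous G (subg_val x))).
Qed.

HB.instance Definition _ :=
  isTopGroup.Build T subg_mulg_continuous subg_invg_continuous.

End SubgroupTopGroup.

Section Normaliser.
Variables (G : topGroupType) (K : subgroup G).

Definition normaliser_set : set G :=
  [set g | [set (g * k * g^-1)%g | k in K] = K].

Lemma normaliser_setP g : normaliser_set g <->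
  forall k, subgroup_set K k <-> subgroup_set K (g * k * g^-1)%g.
Proof.
split=> [Ng k|Ng].
  rewrite -[X in _ <-> X _]Ng; split=> [Kk|[k' Kk' e]]; first by exists k.
  by rewrite -(mulgI _ _ _ (mulIg _ _ _ e)).
apply/seteqP; split=> [_ [k Kk <-]|k Kk]; first exact: (Ng k).1 Kk.
exists (g^-1 * k * g)%g; last by rewrite !mulgA mulgV mul1g mulgK.
by apply: (Ng _).2; rewrite !mulgA mulgV mul1g mulgK.
Qed.

Fact normaliser1 : normaliser_set 1%g.
Proof. by apply/normaliser_setP => k; rewrite invg1 mulg1 mul1g. Qed.

Fact normaliserM x y : normaliser_set x -> normaliser_set y ->
  normaliser_set (x * y)%g.
Proof.
move=> /normaliser_setP Nx /normaliser_setP Ny; apply/normaliser_setP => k.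
have -> : (x * y * k * (x * y)^-1 = x * (y * k * y^-1) * x^-1)%g.
  by rewrite invgM !mulgA.
exact: iff_trans (Ny k) (Nx _).
Qed.

Fact normaliserV x : normaliser_set x -> normaliser_set x^-1%g.
Proof.
move=> /normaliser_setP Nx; apply/normaliser_setP => k.
rewrite invgK; apply: iff_sym; apply: iff_trans (Nx _) _.
by rewrite !mulgA mulgV mul1g mulgK.
Qed.

Definition normaliser : subgroup G :=
  Subgroup normaliser1 normaliserM normaliserV.

End Normaliser.

(* The quotient group [N_G(K) / K] with the quotient topology. *)
Section NormaliserQuotient.
Variables (G : topGroupType) (K : subgroup G).
Local Notation N := (subgroup_type (normaliser K)).

Definition same_coset (x y : N) : bool := subg_val (x^-1 * y)%g \in (K : set G).

Lemma same_cosetP x y : same_coset x y <-> subgroup_set K (subg_val (x^-1 * y)%g).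
Proof. by split=> [/set_mem|/mem_set]. Qed.

Fact same_coset_refl : reflexive same_coset.
Proof. by move=> x; apply/same_cosetP; rewrite mulVg; exact: subgroup1. Qed.

Fact same_coset_sym : symmetric same_coset.
Proof.
suff H x y : same_coset x y -> same_coset y x.
  by move=> x y; apply/idP/idP; exact: H.
move=> /same_cosetP/subgroupV; rewrite -[(subg_val _)^-1%g]/(subg_val _^-1)%g.
by rewrite invgM invgK => /same_cosetP.
Qed.

Fact same_coset_trans : transitive same_coset.
Proof.
move=> y x z /same_cosetP Kxy /same_cosetP Kyz; apply/same_cosetP.
move: (subgroupM Kxy Kyz); rewrite -[(_ * _)%g]/(subg_val ((_ * _) * (_ * _)))%g.
by rewrite mulgA mulgK.
Qed.

Canonical same_coset_equiv :=
  EquivRel same_coset same_coset_refl same_coset_sym same_coset_trans.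

Definition normaliser_quotient : Type :=
  quotient_topology {eq_quot same_coset}.
Local Notation Q := normaliser_quotient.

HB.instance Definition _ :=
  Topological.copy Q (quotient_topology {eq_quot same_coset}).

Definition coset_proj (x : N) : Q := \pi_({eq_quot same_coset})%qT x.

Lemma coset_proj_eq x y : coset_proj x = coset_proj y <-> same_coset x y.
Proof. by split=> /eqmodP. Qed.

Lemma coset_projP (q : Q) : exists x, coset_proj x = q.
Proof. by exists (repr (q : {eq_quot same_coset})); exact: reprK. Qed.

Lemma normaliser_conj (y : N) k :
  subgroup_set K k <-> subgroup_set K ((subg_val y)^-1 * k * subg_val y)%g.
Proof.
have /normaliser_setP/(_ k) := normaliserV (subg_valP y).
by rewrite invgK.
Qed.

Definition quo_one : Q := coset_proj 1%g.
Definition quo_mul (p q : Q) : Q :=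
  coset_proj (repr (p : {eq_quot same_coset}) * repr (q : {eq_quot same_coset}))%g.
Definition quo_inv (p : Q) : Q :=
  coset_proj (repr (p : {eq_quot same_coset}))^-1%g.

Lemma same_coset_repr x :
  same_coset (repr (coset_proj x : {eq_quot same_coset})) x.
Proof. by apply/coset_proj_eq; exact: reprK. Qed.

Lemma coset_projM x y :
  quo_mul (coset_proj x) (coset_proj y) = coset_proj (x * y)%g.
Proof.
apply/coset_proj_eq/same_cosetP.
set x' := repr _; set y' := repr _.
have /same_cosetP Kx : same_coset x' x := same_coset_repr x.
have /same_cosetP Ky : same_coset y' y := same_coset_repr y.
have -> : ((x' * y')^-1 * (x * y) = y'^-1 * (x'^-1 * x) * y' * (y'^-1 * y))%g.
  by rewrite invgM !mulgA mulgK.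
exact: (subgroupM ((normaliser_conj y' _).1 Kx) Ky).
Qed.

Lemma coset_projV x : quo_inv (coset_proj x) = coset_proj x^-1%g.
Proof.
apply/coset_proj_eq/same_cosetP.
set x' := repr _.
have /same_cosetP Kx : same_coset x' x := same_coset_repr x.
apply: (normaliser_conj x _).2.
have e : (x^-1 * (x'^-1^-1 * x^-1) * x = x^-1 * x')%g.
  by rewrite invgK !mulgA mulgVK.
rewrite -[X in subgroup_set K X]/(subg_val (x^-1 * (x'^-1^-1 * x^-1) * x)%g) e.
apply/same_cosetP; rewrite same_coset_sym; exact: same_coset_repr.
Qed.

Fact quo_mulA : associative quo_mul.
Proof.
move=> p q r.
have [[[x <-] [y <-]] [z <-]] := (coset_projP p, coset_projP q, coset_projP r).
by rewrite !coset_projM mulgA.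
Qed.
Fact quo_mul1 : left_id quo_one quo_mul.
Proof. by move=> p; have [x <-] := coset_projP p; rewrite coset_projM mul1g. Qed.
Fact quo_1mul : right_id quo_one quo_mul.
Proof. by move=> p; have [x <-] := coset_projP p; rewrite coset_projM mulg1. Qed.
Fact quo_mulV : left_inverse quo_one quo_inv quo_mul.
Proof.
by move=> p; have [x <-] := coset_projP p; rewrite coset_projV coset_projM mulVg.
Qed.
Fact quo_Vmul : right_inverse quo_one quo_inv quo_mul.
Proof.
by move=> p; have [x <-] := coset_projP p; rewrite coset_projV coset_projM mulgV.
Qed.

HB.instance Definition _ :=
  isGroup.Build Q quo_mulA quo_mul1 quo_1mul quo_mulV quo_Vmul.

Lemma coset_proj_continuous : continuous coset_proj.
Proof. exact: pi_continuous. Qed.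

Lemma coset_proj_open (U : set N) : open U -> open (coset_proj @` U).
Proof.
move=> oU.
suff -> : open (coset_proj @` U) = open (coset_proj @^-1` (coset_proj @` U)).
  suff -> : coset_proj @^-1` (coset_proj @` U) =
      \bigcup_(k in [set k : N | subgroup_set K (subg_val k)])
        (fun x => x * k)%g @^-1` U.
    apply: bigcup_open => k _.
    suff /continuousP/(_ _ oU) : continuous (fun x : N => x * k)%g by [].
    move=> x; apply: (@continuous_comp _ _ _ (fun y : N => (y, k))
      (fun y => y.1 * y.2)%g); last exact: mulg_continuous.
    exact: (@cvg_pair _ _ _ (nbhs x) (nbhs x) (nbhs k) _ _ _ id (cst k)
      cvg_id (cvg_cst k)).
  apply/seteqP; split=> [x [y Uy /coset_proj_eq /same_cosetP Kyx]|x [k Kk Uxk]].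
    exists (x^-1 * y)%g; last by rewrite /= mulgA mulgV mul1g.
    have -> : (x^-1 * y = (y^-1 * x)^-1)%g by rewrite invgM invgK.
    exact: subgroupV Kyx.
  exists (x * k)%g => //; apply/coset_proj_eq; rewrite same_coset_sym.
  by apply/same_cosetP; rewrite mulKg.
by [].
Qed.

Fact quo_mulg_continuous : continuous (fun x : Q * Q => (x.1 * x.2)%g).
Proof.
move=> [p q]; have [[x <-] [y <-]] := (coset_projP p, coset_projP q).
move=> W /=; rewrite -[(_ * _)%g]/(quo_mul _ _) coset_projM => nW.
have : nbhs (x, y) [set z : N * N | W (coset_proj (z.1 * z.2)%g)].
  apply: (@continuous_comp _ _ _ (fun z : N * N => z.1 * z.2)%g coset_proj
    (x, y)) => //; [exact: mulg_continuous|exact: coset_proj_continuous].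
case=> -[A B] /= [nA nB] AB.
exists (coset_proj @` A°, coset_proj @` B°) => /=.
  split; apply: open_nbhs_nbhs; split.
  - exact: coset_proj_open (open_interior A).
  - by exists x => //; exact: nA.
  - exact: coset_proj_open (open_interior B).
  - by exists y => //; exact: nB.
move=> [_ _] /= [[a Aa <-] [b Bb <-]].
rewrite -[(_ * _)%g]/(quo_mul _ _) coset_projM.
by apply: (AB (a, b)); split => /=; exact: interior_subset.
Qed.

Fact quo_invg_continuous : continuous (fun x : Q => x^-1%g).
Proof.
apply/continuousP => U oU.
suff : open (coset_proj @^-1` ((fun x : Q => x^-1%g) @^-1` U)) by [].
have -> : coset_proj @^-1` ((fun x : Q => x^-1%g) @^-1` U) =
    (fun x : N => x^-1%g) @^-1` (coset_proj @^-1` U).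
  by apply/funext => x /=; rewrite -[(coset_proj x)^-1%g]/(quo_inv _) coset_projV.
have /continuousP := @invg_continuous N; apply.
have /continuousP := coset_proj_continuous; exact.
Qed.

HB.instance Definition _ :=
  isTopGroup.Build Q quo_mulg_continuous quo_invg_continuous.

End NormaliserQuotient.

Section SupNorm.
Variables (R : realType) (I : Type).
Implicit Types (A : set I) (h : I -> R[i]) (M : R[i]).

(* Embedded in [R[i]] because norms of modules over [R[i]] are [R[i]]-valued. *)
Definition supnorm A h : R[i] := (sup [set normc (h i) | i in A])%:C%C.

Lemma norm_normc (z : R[i]) : `|z| = (normc z)%:C%C.
Proof. by rewrite normc_def; case: z. Qed.

Lemma ge0_RReK M : 0 <= M -> (complex.Re M)%:C%C = M.
Proof. by move=> M0; apply: RRe_real; exact: ger0_real. Qed.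

Lemma supnorm_ubound A h M : (forall i, A i -> `|h i| <= M) ->
  has_ubound [set normc (h i) | i in A].
Proof.
move=> hM; exists (complex.Re M) => _ [i Ai <-].
have M0 : 0 <= M := le_trans (normr_ge0 _) (hM i Ai).
by rewrite -lecR ge0_RReK// -norm_normc hM.
Qed.

Lemma le_supnorm A h M i : (forall j, A j -> `|h j| <= M) -> A i ->
  `|h i| <= supnorm A h.
Proof.
move=> hM Ai; rewrite norm_normc lecR; apply: ub_le_sup; last by exists i.
exact: supnorm_ubound hM.
Qed.

Lemma supnorm_le A h M : 0 <= M -> (forall i, A i -> `|h i| <= M) ->
  supnorm A h <= M.
Proof.
move=> M0 hM; rewrite -(ge0_RReK M0) lecR.
have [[i Ai]|/nonemptyPn A0] := pselect (A !=set0); last first.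
  by rewrite A0 image_set0 sup0 -lecR ge0_RReK.
apply: ge_sup => [|_ [j Aj <-]]; first by exists (normc (h i)), i.
by rewrite -lecR ge0_RReK// -norm_normc hM.
Qed.

Lemma supnorm_ge0 A h : 0 <= supnorm A h.
Proof.
rewrite lecR; have [E|/sup_out ->//] :=
  pselect (has_sup [set normc (h i) | i in A]).
have [_ [i Ai _]] := E.1; apply: le_trans (_ : normc (h i) <= _).
  by rewrite -lecR -norm_normc; exact: normr_ge0.
by apply: ub_le_sup; [exact: E.2|exists i].
Qed.

Lemma supnorm_adherent A h M e : A !=set0 -> (forall i, A i -> `|h i| <= M) ->
  0 < e -> exists2 i, A i & supnorm A h - e < `|h i|.
Proof.
move=> [i0 Ai0] hM e0.
have re0 : 0 < complex.Re e by rewrite -ltcR ge0_RReK// ltW.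
have [|_ [i Ai <-] lti] := @sup_adherent R [set normc (h i) | i in A] _ re0.
  by split; [exists (normc (h i0)), i0|exact: supnorm_ubound hM].
exists i => //; rewrite norm_normc -(ge0_RReK (ltW e0)).
by rewrite /supnorm -rmorphB ltcR.
Qed.

End SupNorm.

Section C0.
Variables (R : realType) (T : topologicalType).

Definition vanishes_at_infinity (f : T -> R[i]) :=
  forall e : R[i], 0 < e ->
    exists2 A : set T, compact A & forall x, ~ A x -> `|f x| < e.

Definition C0_pred : {pred T -> R[i]} :=
  [pred f : T -> R[i] | `[< continuous f /\ vanishes_at_infinity f >]].

Lemma C0_predP f :
  reflect (continuous f /\ vanishes_at_infinity f) (f \in C0_pred).
Proof. exact: asboolP. Qed.

Fact C0_submod : GRing.submod_closed C0_pred.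
Proof.
split=> [|a f g /C0_predP[cf vf] /C0_predP[cg vg]]; apply/C0_predP.
  split=> [x|e e0]; first exact: cvg_cst.
  by exists set0 => [|x _]; [exact: compact0|rewrite normr0].
split=> [x|e e0].
  by apply: cvgD; [apply: cvgZr; exact: cf|exact: cg].
have d0 : 0 < e / 2 / (`|a| + 1).
  by rewrite !divr_gt0// ltr_wpDl.
have [A cA fA] := vf _ d0.
have [B cB gB] := vg _ (divr_gt0 e0 (ltr0n R[i] 2)).
exists (A `|` B) => [|x /not_orP[nA nB]]; first exact: compactU.
rewrite [e in _ < e]splitr; apply: le_lt_trans (ler_normD _ _) _.
apply: ler_ltD; last exact: gB.
rewrite normrZ; apply: le_trans (_ : (`|a| + 1) * `|f x| <= _).
  by rewrite ler_wpM2r// lerDl.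
by rewrite mulrC -ler_pdivlMr ?ltr_wpDl// ltW// fA.
Qed.

HB.instance Definition _ :=
  GRing.isSubmodClosed.Build R[i] (T -> R[i]) C0_pred C0_submod.

Record C0 := MkC0 { C0_fun :> T -> R[i]; C0_funP : C0_fun \in C0_pred }.

HB.instance Definition _ := [isSub for C0_fun].
HB.instance Definition _ := [Choice of C0 by <:].
HB.instance Definition _ := [SubChoice_isSubLmodule of C0 by <:].

Lemma C0_continuous (f : C0) : continuous f.
Proof. by case: (C0_predP _ (C0_funP f)). Qed.

Lemma C0_vanishes (f : C0) : vanishes_at_infinity f.
Proof. by case: (C0_predP _ (C0_funP f)). Qed.

Lemma C0P (f g : C0) : f =1 g -> f = g.
Proof. by move=> fg; apply: val_inj; apply/funext. Qed.

Lemma C0_bounded (f : C0) : exists2 M : R[i], 0 <= M & forall x, `|f x| <= M.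
Proof.
have [A cA fA] := C0_vanishes f (@ltr01 R[i]).
have cn := (iffLR (compact_near_coveringP A)) cA.
have [|M [Mr MP]] := cn R[i] +oo (fun M x => `|f x| <= M) _.
  move=> x _; exists ([set y | `|f x - f y| < 1], [set M | `|f x| + 1 < M]).
    split => /=; last by apply: nbhs_pinfty_gt; rewrite realD// ?normr_real.
    have /cvgrPdist_lt := @C0_continuous f x.
    exact.
  move=> [y M] /= [fxy fM]; apply: ltW; apply: le_lt_trans fM.
  rewrite -[f y](subrK (f x)) addrC; apply: le_trans (ler_normD _ _) _.
  by rewrite lerD2l distrC ltW.
pose N : R[i] := `|M| + 1; exists N => [|x]; first by rewrite addr_ge0.
have MN : M < N by rewrite ltr_pwDr// real_ler_norm.
have [Ax|/fA/ltW fx] := pselect (A x); first exact: (MP _ MN).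
by apply: le_trans fx _; rewrite lerDr.
Qed.

Definition C0_norm (f : C0) : R[i] := supnorm setT f.

Lemma le_C0_norm (f : C0) x : `|f x| <= C0_norm f.
Proof. by have [M _ fM] := C0_bounded f; apply: le_supnorm (fun j _ => fM j) _. Qed.

Lemma C0_norm_le (f : C0) M : 0 <= M -> (forall x, `|f x| <= M) -> C0_norm f <= M.
Proof. by move=> M0 fM; apply: supnorm_le. Qed.

Fact C0_ler_normD (f g : C0) : C0_norm (f + g) <= C0_norm f + C0_norm g.
Proof.
apply: C0_norm_le => [|x]; first by rewrite addr_ge0// supnorm_ge0.
by apply: le_trans (ler_normD _ _) _; apply: lerD; exact: le_C0_norm.
Qed.

Fact C0_normrZ (a : R[i]) (f : C0) : C0_norm (a *: f) = `|a| * C0_norm f.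
Proof.
have le b (g : C0) : C0_norm (b *: g) <= `|b| * C0_norm g.
  apply: C0_norm_le => [|x]; first by rewrite mulr_ge0// supnorm_ge0.
  by rewrite normrZ ler_wpM2l// le_C0_norm.
apply/le_anti/andP; split=> //.
have [->|a0] := eqVneq a 0; first by rewrite normr0 mul0r supnorm_ge0.
rewrite -ler_pdivlMl ?normr_gt0// -normfV.
by apply: le_trans (le _ _); rewrite scalerA mulVf// scale1r.
Qed.

Fact C0_normr0_eq0 (f : C0) : C0_norm f = 0 -> f = 0.
Proof.
move=> f0; apply: C0P => x; apply/eqP; rewrite -normr_le0 -f0; exact: le_C0_norm.
Qed.

HB.instance Definition _ := Lmodule_isNormed.Build R[i] C0
  C0_ler_normD C0_normrZ C0_normr0_eq0.

Lemma C0_normE (f : C0) : `|f| = supnorm setT f. Proof. by []. Qed.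

End C0.

Section Dual.
Variables (R : realType) (V : normedModType R[i]).

Definition dual_pred : {pred V -> R[i]} :=
  [pred f : V -> R[i] | `[< linear f /\ continuous f >]].

Lemma dual_predP f : reflect (linear f /\ continuous f) (f \in dual_pred).
Proof. exact: asboolP. Qed.

Fact dual_submod : GRing.submod_closed dual_pred.
Proof.
split=> [|a f g /dual_predP[lf cf] /dual_predP[lg cg]]; apply/dual_predP.
  by split=> [b u v|x]; [rewrite scaler0 addr0|exact: cvg_cst].
split=> [b u v|x]; last by apply: cvgD; [apply: cvgZr; exact: cf|exact: cg].
rewrite -[LHS]/(a *: f _ + g _) lf lg.
rewrite -[RHS]/(b *: (a *: f u + g u) + (a *: f v + g v)).
by rewrite !scalerDr !scalerA [b * a]mulrC !addrA; congr (_ + _); rewrite addrAC.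
Qed.

HB.instance Definition _ :=
  GRing.isSubmodClosed.Build R[i] (V -> R[i]) dual_pred dual_submod.

Record dual := MkDual { dual_fun :> V -> R[i]; dual_funP : dual_fun \in dual_pred }.

HB.instance Definition _ := [isSub for dual_fun].
HB.instance Definition _ := [Choice of dual by <:].
HB.instance Definition _ := [SubChoice_isSubLmodule of dual by <:].

Lemma dual_linear (f : dual) : linear f.
Proof. by case: (dual_predP _ (dual_funP f)). Qed.

HB.instance Definition _ (f : dual) :=
  GRing.isLinear.Build R[i] V R[i] *:%R f (dual_linear f).

Lemma dual_continuous (f : dual) : continuous f.
Proof. by case: (dual_predP _ (dual_funP f)). Qed.

Lemma dualP (f g : dual) : f =1 g -> f = g.
Proof. by move=> fg; apply: val_inj; apply/funext. Qed.

Lemma dual_bounded (f : dual) :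
  exists2 M : R[i], 0 <= M & forall v, `|f v| <= M * `|v|.
Proof.
have := @continuous_linear_bounded R[i] V R[i] 0 f (@dual_continuous f 0).
move=> /(linear_boundedP (f : {linear V -> R[i]}))[M [Mr MP]].
exists (`|M| + 1) => [|v]; first by rewrite addr_ge0.
by apply: MP; rewrite ltr_pwDr// real_ler_norm.
Qed.

Definition dual_norm (f : dual) : R[i] := supnorm [set v | `|v| <= 1] f.

Lemma dual_ball_bounded (f : dual) :
  exists2 M : R[i], 0 <= M & forall v, [set v | `|v| <= 1] v -> `|f v| <= M.
Proof.
have [M M0 fM] := dual_bounded f; exists M => // v /= v1.
by apply: le_trans (fM v) _; rewrite ler_piMr.
Qed.

Lemma le_dual_norm (f : dual) v : `|f v| <= dual_norm f * `|v|.
Proof.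
have [M M0 fM] := dual_ball_bounded f.
have [->|v0] := eqVneq v 0; first by rewrite linear0 !normr0 mulr0.
have nv : 0 < `|v| by rewrite normr_gt0.
have -> : `|f v| = `|f (`|v|^-1 *: v)| * `|v|.
  by rewrite linearZ normrZ normfV normr_id mulrAC mulVf ?mul1r// gt_eqF.
rewrite ler_wpM2r//; apply: le_supnorm fM _ => /=.
by rewrite normrZ normfV normr_id mulVf// gt_eqF.
Qed.

Lemma dual_norm_le (f : dual) M : 0 <= M -> (forall v, `|f v| <= M * `|v|) ->
  dual_norm f <= M.
Proof.
move=> M0 fM; apply: supnorm_le => // v /= v1.
by apply: le_trans (fM v) _; rewrite ler_piMr.
Qed.

Fact dual_ler_normD (f g : dual) : dual_norm (f + g) <= dual_norm f + dual_norm g.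
Proof.
apply: dual_norm_le => [|v]; first by rewrite addr_ge0// supnorm_ge0.
rewrite mulrDl; apply: le_trans (ler_normD _ _) _.
by apply: lerD; exact: le_dual_norm.
Qed.

Fact dual_normrZ (a : R[i]) (f : dual) : dual_norm (a *: f) = `|a| * dual_norm f.
Proof.
have le b (g : dual) : dual_norm (b *: g) <= `|b| * dual_norm g.
  apply: dual_norm_le => [|v]; first by rewrite mulr_ge0// supnorm_ge0.
  by rewrite normrZ -mulrA ler_wpM2l// le_dual_norm.
apply/le_anti/andP; split=> //.
have [->|a0] := eqVneq a 0; first by rewrite normr0 mul0r supnorm_ge0.
rewrite -ler_pdivlMl ?normr_gt0// -normfV.
by apply: le_trans (le _ _); rewrite scalerA mulVf// scale1r.
Qed.

Fact dual_normr0_eq0 (f : dual) : dual_norm f = 0 -> f = 0.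
Proof.
move=> f0; apply: dualP => v; apply/eqP; rewrite -normr_le0.
by apply: le_trans (le_dual_norm f v) _; rewrite f0 mul0r.
Qed.

HB.instance Definition _ := Lmodule_isNormed.Build R[i] dual
  dual_ler_normD dual_normrZ dual_normr0_eq0.

Lemma dual_normE (f : dual) : `|f| = supnorm [set v | `|v| <= 1] f.
Proof. by []. Qed.

Lemma bounded_dual_pred (f : V -> R[i]) (M : R[i]) : linear f -> 0 <= M ->
  (forall v, `|f v| <= M * `|v|) -> f \in dual_pred.
Proof.
move=> lf M0 fM; apply/dual_predP; split=> // x.
apply/cvgrPdist_lt => e e0.
have M1 : 0 < M + 1 by rewrite ltr_wpDl.
have : \forall y \near x, `|x - y| < e / (M + 1).
  by have /cvgrPdist_lt := @cvg_id _ (nbhs x); apply; rewrite divr_gt0.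
apply: filterS => y; rewrite ltr_pdivlMr// => xy.
have -> : f x - f y = f (x - y).
  by rewrite [x - y]addrC; move: (lf (-1) y x); rewrite !scaleN1r => ->; rewrite addrC.
apply: le_lt_trans (fM _) _; apply: le_lt_trans xy.
by rewrite mulrC ler_wpM2l// lerDl.
Qed.

End Dual.

Section MeasureAlgebra.
Variables (R : realType) (G : topGroupType).
Local Notation C0G := (C0 R G).

(* [M(G)], the bounded regular complex Borel measures, as the Banach dual of
   [C_0(G)]: [nu u] is the integral of [u] with respect to [nu], and the operator
   norm is the total variation. *)
Definition measure_algebra : Type := dual C0G.
Local Notation M := measure_algebra.
HB.instance Definition _ := NormedModule.copy M (dual C0G).

Lemma continuous_mulg (T : topologicalType) (f g : T -> G) :
  continuous f -> continuous g -> continuous (fun x => f x * g x)%g.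
Proof.
move=> cf cg x.
apply: (@continuous_comp _ _ _ (fun y => (f y, g y)) (fun y => y.1 * y.2)%g).
  exact: (@cvg_pair _ _ _ (nbhs x) (nbhs (f x)) (nbhs (g x)) _ _ _ f g
    (cf x) (cg x)).
exact: mulg_continuous.
Qed.

Lemma continuous_invg (T : topologicalType) (f : T -> G) :
  continuous f -> continuous (fun x => (f x)^-1)%g.
Proof.
move=> cf x.
exact: (@cvg_comp _ _ _ f (fun y => y^-1)%g _ _ _ (cf x)
  (@invg_continuous G (f x))).
Qed.

Lemma continuous_C0 (T : topologicalType) (u : C0G) (f : T -> G) :
  continuous f -> continuous (fun x => u (f x)).
Proof.
move=> cf x; exact: (@cvg_comp _ _ _ f u _ _ _ (cf x) (@C0_continuous _ _ u _)).
Qed.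

Lemma compact_image (T S : topologicalType) (f : T -> S) (A : set T) :
  continuous f -> compact A -> compact (f @` A).
Proof. by move=> cf; apply: continuous_compact; exact: continuous_subspaceT. Qed.

Lemma cst_continuousg (T : topologicalType) (g : G) :
  continuous (fun _ : T => g).
Proof. by move=> x; exact: cvg_cst. Qed.

Lemma id_continuousg : continuous (fun x : G => x).
Proof. by move=> x; exact: cvg_id. Qed.

Fact translate_subproof (s : G) (u : C0G) :
  (fun t => u (s * t)%g) \in @C0_pred R G.
Proof.
apply/C0_predP; split=> [|e e0].
  apply: continuous_C0; apply: continuous_mulg;
    [exact: cst_continuousg|exact: id_continuousg].
have [A cA uA] := C0_vanishes u e0.
exists ((fun t => s^-1 * t)%g @` A) => [|t nt].
  apply: compact_image cA; apply: continuous_mulg;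
    [exact: cst_continuousg|exact: id_continuousg].
by apply: uA => As; apply: nt; exists (s * t)%g; rewrite ?mulKg.
Qed.

Definition translate (s : G) (u : C0G) : C0G := MkC0 (translate_subproof s u).

Lemma norm_translate s u : `|translate s u| <= `|u|.
Proof.
by apply: C0_norm_le => [|t]; [exact: supnorm_ge0|exact: (le_C0_norm u (s * t)%g)].
Qed.

Lemma translateD a s u v :
  translate s (a *: u + v) = a *: translate s u + translate s v.
Proof. exact: C0P. Qed.

Lemma translate_continuous (u : C0G) : continuous (translate ^~ u).
Proof.
move=> s0; apply/cvgrPdist_le => e e0.
have e2 : 0 < e / 2 by rewrite divr_gt0.
have [A cA uA] := C0_vanishes u e2.
have near1 : \forall s \near s0, forall a, A a -> `|u a - u (s0 * s^-1 * a)%g| < e.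
  have cn := (iffLR (compact_near_coveringP A)) cA.
  apply: cn => a _.
  have ch : continuous (fun z : G * G => u z.1 - u (s0 * z.2^-1 * z.1)%g).
    have c1 : continuous (fun z : G * G => z.1) by move=> x; exact: cvg_fst.
    have c2 : continuous (fun z : G * G => z.2) by move=> x; exact: cvg_snd.
    move=> z; apply: cvgB; first exact: (@continuous_C0 _ u _ c1 z).
    suff c3 : continuous (fun z : G * G => s0 * z.2^-1 * z.1)%g.
      exact: (@continuous_C0 _ u _ c3 z).
    apply: continuous_mulg c1; apply: continuous_mulg (continuous_invg c2).
    exact: cst_continuousg.
  have /cvgrPdist_lt/(_ _ e0) := ch (a, s0).
  rewrite /= mulgV mul1g subrr.
  by apply: filterS => z; rewrite sub0r normrN.
have near2 : \forall s \near s0, forall a, A a -> `|u a - u (s * s0^-1 * a)%g| < e.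
  have cn := (iffLR (compact_near_coveringP A)) cA.
  apply: cn => a _.
  have ch : continuous (fun z : G * G => u z.1 - u (z.2 * s0^-1 * z.1)%g).
    have c1 : continuous (fun z : G * G => z.1) by move=> x; exact: cvg_fst.
    have c2 : continuous (fun z : G * G => z.2) by move=> x; exact: cvg_snd.
    move=> z; apply: cvgB; first exact: (@continuous_C0 _ u _ c1 z).
    suff c3 : continuous (fun z : G * G => z.2 * s0^-1 * z.1)%g.
      exact: (@continuous_C0 _ u _ c3 z).
    apply: continuous_mulg c1; apply: continuous_mulg c2 _.
    exact: cst_continuousg.
  have /cvgrPdist_lt/(_ _ e0) := ch (a, s0).
  rewrite /= mulgV mul1g subrr.
  by apply: filterS => z; rewrite sub0r normrN.
apply: filterS2 near1 near2 => s h1 h2.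
apply: C0_norm_le => [|t]; first exact: ltW.
rewrite -[X in `|X|]/(u (s0 * t)%g - u (s * t)%g).
have [As|nAs] := pselect (A (s * t)%g).
  by have := h1 _ As; rewrite mulgA mulgVK distrC => /ltW.
have [As0|nAs0] := pselect (A (s0 * t)%g).
  by have := h2 _ As0; rewrite mulgA mulgVK => /ltW.
apply: le_trans (ler_normB _ _) _; rewrite [e]splitr; apply: lerD;
  by apply: ltW; exact: uA.
Qed.

Lemma unimodular_align (a b : R[i]) :
  exists2 c : R[i], `|c| <= 1 & `|a| + `|b| <= `|a + c * b|.
Proof.
have [->|a0] := eqVneq a 0.
  by exists 1; rewrite ?normr1// normr0 !add0r mul1r.
have [->|b0] := eqVneq b 0.
  by exists 1; rewrite ?normr1// normr0 mulr0 !addr0.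
have na0 : `|a| != 0 by rewrite normr_eq0.
have nb0 : `|b| != 0 by rewrite normr_eq0.
exists (a / `|a| * (`|b| / b)).
  by rewrite !normrM !normfV !normr_id !divff// mulr1.
have -> : a + a / `|a| * (`|b| / b) * b = a / `|a| * (`|a| + `|b|).
  by rewrite -mulrA divfK// mulrDr divfK.
by rewrite normrM normf_div normr_id divff// mul1r ger0_norm// addr_ge0.
Qed.

(* A measure is tight: a test function bounded by [1] that is small on a large
   compact set has a small integral. *)
Lemma dual_tight (nu : M) (e : R[i]) : 0 < e ->
  exists2 B : set G, compact B & exists2 d : R[i], 0 < d &
  forall w : C0G, `|w| <= 1 -> (forall x, B x -> `|w x| < d) -> `|nu w| < e.
Proof.
move=> e0; pose d := e / 2 / (`|nu| + 1).
have n1 : 0 < `|nu| + 1 by rewrite ltr_wpDl.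
have d0 : 0 < d by rewrite !divr_gt0.
have ne : [set v : C0G | `|v| <= 1] !=set0 by exists 0; rewrite /= normr0.
have [m _ num] := dual_ball_bounded nu.
have [v /= v1 vd] := supnorm_adherent ne num d0.
have [B cB vB] := C0_vanishes v d0.
exists B => //; exists d => // w w1 wB.
have [c c1 vw] := unimodular_align (nu v) (nu w).
have vwE : nu v + c * nu w = nu (v + c *: w) by rewrite linearD linearZ.
have nvw : `|v + c *: w| <= 1 + d.
  apply: C0_norm_le => [|x]; first by rewrite addr_ge0// ltW.
  apply: le_trans (ler_normD _ _) _.
  have vx : `|v x| <= 1 := le_trans (le_C0_norm v x) v1.
  have wx : `|w x| <= 1 := le_trans (le_C0_norm w x) w1.
  have cwx : `|c *: w x| <= `|w x| by rewrite normrZ ler_piMl.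
  have [Bx|nBx] := pselect (B x).
    by apply: lerD => //; apply: le_trans cwx _; exact/ltW/wB.
  rewrite addrC; apply: lerD; first exact: le_trans cwx _.
  exact/ltW/vB.
have key : `|nu v| + `|nu w| <= `|nu| * (1 + d).
  apply: le_trans vw _; rewrite vwE; apply: le_trans (le_dual_norm _ _) _.
  by rewrite ler_wpM2l// supnorm_ge0.
have : `|nu| - d + `|nu w| <= `|nu| * (1 + d).
  by apply: le_trans key; rewrite lerD2r ltW.
rewrite mulrDr mulr1 -addrA lerD2l addrC lerBlDr => h.
apply: le_lt_trans h _; rewrite -[X in _ + X]mul1r -mulrDl.
by rewrite /d mulrC divfK ?gt_eqF// ltr_pdivrMr// ltr_pMr// ltr1n.
Qed.

Fact slice_subproof (nu : M) (u : C0G) :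
  (fun s => nu (translate s u)) \in @C0_pred R G.
Proof.
apply/C0_predP; split=> [s|e e0].
  exact: (@cvg_comp _ _ _ (translate ^~ u) nu _ _ _ (@translate_continuous u s)
    (@dual_continuous _ _ nu _)).
pose c : R[i] := `|u| + 1.
have c0 : 0 < c by rewrite ltr_wpDl.
have [B cB [d d0 nuB]] := dual_tight nu (divr_gt0 e0 c0).
have [A cA uA] := C0_vanishes u (mulr_gt0 c0 d0).
exists ((fun z : G * G => z.1 * z.2^-1)%g @` (A `*` B)) => [|s ns].
  apply: compact_image; last exact: compact_setX.
  apply: continuous_mulg; first by move=> x; exact: cvg_fst.
  by apply: continuous_invg => x; exact: cvg_snd.
have cn : `|c| = c by rewrite gtr0_norm.
have nc : `|c^-1 *: translate s u| <= 1.
  rewrite normrZ normfV cn ler_pdivrMl// mulr1.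
  by apply: le_trans (norm_translate s u) _; rewrite lerDl.
have := nuB _ nc; rewrite linearZ normrZ normfV cn ltr_pdivlMr//.
rewrite mulrAC mulVf ?mul1r ?gt_eqF//; apply => x Bx.
rewrite -[X in `|X|]/(c^-1 *: u (s * x)%g) normrZ normfV cn ltr_pdivrMl//.
apply: uA => Asx; apply: ns; exists ((s * x)%g, x) => //=.
by rewrite mulgK.
Qed.

Definition slice (nu : M) (u : C0G) : C0G := MkC0 (slice_subproof nu u).

Lemma norm_slice nu u : `|slice nu u| <= `|nu| * `|u|.
Proof.
apply: C0_norm_le => [|s]; first by rewrite mulr_ge0.
apply: le_trans (le_dual_norm _ _) _.
by rewrite ler_wpM2l ?supnorm_ge0// norm_translate.
Qed.

Fact conv_subproof (mu nu : M) : (fun u => mu (slice nu u)) \in @dual_pred R C0G.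
Proof.
apply: (@bounded_dual_pred _ _ _ (`|mu| * `|nu|)) => [a u v||u].
- have -> : slice nu (a *: u + v) = a *: slice nu u + slice nu v.
    by apply: C0P => s /=; rewrite translateD linearP.
  by rewrite linearP.
- by rewrite mulr_ge0.
- apply: le_trans (le_dual_norm _ _) _.
  by rewrite -mulrA ler_wpM2l ?supnorm_ge0// norm_slice.
Qed.

(* The integral of [u] against [conv mu nu] is the iterated integral of
   [u (s * t)], over [t] with respect to [nu], then over [s] with respect to
   [mu]. *)
Definition conv (mu nu : M) : M := MkDual (conv_subproof mu nu).

Fact flip_subproof (u : C0G) : (fun s => (u s^-1%g)^*) \in @C0_pred R G.
Proof.
apply/C0_predP; split=> [s|e e0].
  apply/cvgrPdist_lt => e e0.
  have cu := @continuous_C0 _ u _ (@invg_continuous G).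
  have /cvgrPdist_lt/(_ _ e0) := cu s.
  by apply: filterS => t; rewrite -rmorphB norm_conjC.
have [A cA uA] := C0_vanishes u e0.
exists ((fun x => x^-1)%g @` A) => [|s ns].
  by apply: compact_image cA; exact: invg_continuous.
rewrite norm_conjC; apply: uA => As; apply: ns.
by exists s^-1%g => //; rewrite invgK.
Qed.

Definition flip (u : C0G) : C0G := MkC0 (flip_subproof u).

Fact star_subproof (nu : M) : (fun u => (nu (flip u))^*) \in @dual_pred R C0G.
Proof.
apply: (@bounded_dual_pred _ _ _ `|nu|) => [a u v||u] //.
  have -> : flip (a *: u + v) = a^* *: flip u + flip v.
    by apply: C0P => s /=; rewrite rmorphD rmorphM.
  by rewrite linearP rmorphD rmorphM /= conjCK.
rewrite (_ : `|_| = `|nu (flip u)|); last exact: norm_conjC.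
apply: le_trans (le_dual_norm _ _) _.
rewrite ler_wpM2l ?supnorm_ge0//; apply: C0_norm_le => [|s].
  exact: supnorm_ge0.
by rewrite [X in X <= _]norm_conjC; exact: le_C0_norm.
Qed.

Definition star (nu : M) : M := MkDual (star_subproof nu).

Fact dirac_subproof (g : G) : (fun u : C0G => u g) \in @dual_pred R C0G.
Proof.
apply: (@bounded_dual_pred _ _ _ 1) => // u.
by rewrite mul1r; exact: le_C0_norm.
Qed.

Definition dirac_measure (g : G) : M := MkDual (dirac_subproof g).

End MeasureAlgebra.

Section Hermitian.
Variables (R : realType) (H : topGroupType).

Definition compactly_supported (f : H -> R[i]) :=
  continuous f /\
  exists2 A : set H, compact A & forall x, ~ A x -> f x = 0.

(* A left Haar measure, given by its integral on [C_c(H)]; the values of [lam]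
   outside [C_c(H)] are irrelevant. *)
Record is_haar (lam : (H -> R[i]) -> R[i]) : Prop := IsHaar {
  haar_linear : forall (a : R[i]) f g,
    compactly_supported f -> compactly_supported g ->
    lam (fun x => a * f x + g x) = a * lam f + lam g;
  haar_ge0 : forall f, compactly_supported f -> (forall x, 0 <= f x) ->
    0 <= lam f;
  haar_neq0 : exists2 f, compactly_supported f & lam f != 0;
  haar_translate : forall f (s : H), compactly_supported f ->
    lam (fun x => f (s * x)%g) = lam f }.

(* The group algebra as a closed ideal of [M(H)]: the measures [f lam] with
   [f] in [C_c(H)] have total variation [lam `|f|], so that their norm closure is
   the [L^1]-completion of [C_c(H)]. *)
Definition L1 (lam : (H -> R[i]) -> R[i]) : set (measure_algebra R H) :=
  closure [set nu : measure_algebra R H | exists2 f, compactly_supported f &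
                    forall u : C0 R H, nu u = lam (fun x => f x * u x)].

(* If [H] is discrete, the Dirac mass at [1] belongs to [L1] and this is [L1]
   itself; otherwise it does not, and this is the unitization of [L1]. *)
Definition L1_unitization (lam : (H -> R[i]) -> R[i]) :
    set (measure_algebra R H) :=
  [set nu | exists (z : R[i]) f, L1 lam f /\ nu = z *: dirac_measure R 1%g + f].

Definition L1_spectrum (lam : (H -> R[i]) -> R[i]) (f : measure_algebra R H) :
    set R[i] :=
  [set z | ~ exists2 g, L1_unitization lam g &
      conv (z *: dirac_measure R 1%g - f) g = dirac_measure R 1%g /\
      conv g (z *: dirac_measure R 1%g - f) = dirac_measure R 1%g].

(* Haar measures exist and are unique up to a positive scalar, which changes
   neither [L1] nor spectra. *)
Definition hermitian_group : Prop :=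
  forall lam, is_haar lam -> forall f, L1 lam f -> star f = f ->
    L1_spectrum lam f `<=` [set z | z \is Num.real].

End Hermitian.

Section CompactSubgroup.
Variables (R : realType) (G : topGroupType) (K : subgroup G).

Definition normalised_haar (m : measure_algebra R G) : Prop :=
  exists lam : (subgroup_type K -> R[i]) -> R[i],
    [/\ is_haar lam, lam (fun=> 1) = 1 &
        forall u : C0 R G, m u = lam (fun x => u (subg_val x))].

Definition Gamma_group (m : measure_algebra R G) : set (measure_algebra R G) :=
  [set nu | exists (z : R[i]) (g : G), [/\ `|z| = 1, normaliser_set K g &
              nu = conv (z *: dirac_measure R g) m]].

End CompactSubgroup.

Definition local_unitary (R : realType) (G : topGroupType)
    (m : measure_algebra R G) : set (measure_algebra R G) :=
  [set nu | conv (star nu) nu = m /\ conv nu (star nu) = m].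

Definition abelian_subgroup (G : groupType) (A : subgroup G) : Prop :=
  forall x y, subgroup_set A x -> subgroup_set A y -> (x * y = y * x)%g.

Definition discrete_subgroup (G : topGroupType) (A : subgroup G) : Prop :=
  forall x : subgroup_type A, open [set x].

(* Main.v *)
(** Finite combinations of the cosets [dirac g * m_K], for [g] in [N_G(K)], generate
    a copy of the l^1-algebra of the abstract group [N_G(K)/K] inside [M(G)].  For
    [|a| < 1] the Moebius element [W = (1 - a z^-1) / (1 - a^* z)] at
    [z = dirac g] is unitary and commutes with [m_K], so right multiplication by
    [W] preserves the local unitary group, and letting [a] tend to [0] shows that
    it preserves the component of [m_K].  To first order
    [W = 1 + a^* z - a z^-1]; hence if [v] is close to a combination of finitely
    many cosets and [g] moves these off themselves, then, for a suitable phase of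
    [a], the norm of [v * W] exceeds that of [v] by a fixed amount.  For [v = m_K]
    this yields a local unitary of norm greater than [1], whereas the elements of
    [Gamma] have norm at most [1].  When [N_G(K)/K] is infinite the step can be
    iterated, so the component is unbounded; and a finite Hausdorff quotient is
    discrete and all its subgroups are Hermitian, so that either hypothesis of (ii)
    forces [N_G(K)/K] to be infinite. *)
Require Import Defs.
From HB Require Import structures.
From mathcomp Require Import all_boot all_order all_algebra complex.
From mathcomp Require Import all_classical all_reals topology normedtype.
From mathcomp Require Import sequences ring lra.
Import Order.TTheory GRing.Theory Num.Theory.
Import numFieldNormedType.Exports.

Set Implicit Arguments.
Unset Strict Implicit.
Unset Printing Implicit Defensive.

Local Open Scope classical_set_scope.
Local Open Scope ring_scope.

(** * The normed algebra of measures *)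

Section RealNorm.
Variables (R : realType) (V : normedModType R[i]).
Implicit Types (x y : V) (a : R[i]).

(** The norm as an element of [R], so that estimates can be carried out in a totally ordered field
    and closed by [lra]. *)
Definition nrm x : R := complex.Re `|x|.

Lemma nrmE x : `|x| = (nrm x)%:C%C.
Proof. by rewrite /nrm ge0_RReK. Qed.

Lemma nrm_ge0 x : 0 <= nrm x.
Proof. by rewrite -lecR -nrmE; exact: normr_ge0. Qed.

Lemma nrm0 : nrm (0 : V) = 0.
Proof. by apply: complexI; rewrite -nrmE normr0. Qed.

Lemma nrmN x : nrm (- x) = nrm x.
Proof. by rewrite /nrm normrN. Qed.

Lemma ler_nrmD x y : nrm (x + y) <= nrm x + nrm y.
Proof. by rewrite -lecR rmorphD /= -!nrmE ler_normD. Qed.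

Lemma ler_nrmB x y : nrm x - nrm y <= nrm (x - y).
Proof. by rewrite lerBlDr -{1}(subrK y x) ler_nrmD. Qed.

Lemma ler_nrm_sum (I : Type) (s : seq I) (P : pred I) (F : I -> V) :
  nrm (\sum_(i <- s | P i) F i) <= \sum_(i <- s | P i) nrm (F i).
Proof.
elim/big_ind2 : _ => // [|x1 y1 x2 y2 h1 h2]; first by rewrite nrm0.
by apply: le_trans (ler_nrmD _ _) _; exact: lerD.
Qed.

End RealNorm.

Section RealNormScale.
Variables (R : realType) (V : normedModType R[i]).

Lemma nrmZ (a : R[i]) (x : V) : nrm (a *: x) = nrm a * nrm x.
Proof. by apply: complexI; rewrite rmorphM /= -!nrmE normrZ. Qed.

Lemma nrmM (a b : R[i]) : nrm (a * b) = nrm a * nrm b.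
Proof. by apply: complexI; rewrite rmorphM /= -!nrmE normrM. Qed.

Lemma nrm_conj (a : R[i]) : nrm a^* = nrm a.
Proof. by rewrite /nrm norm_conjC. Qed.

Lemma nrm_real (t : R) : nrm (t%:C%C : R[i]) = `|t|.
Proof. by rewrite /nrm norm_normc /= expr0n /= addr0 sqrtr_sqr. Qed.

Lemma nrm1 : nrm (1 : R[i]) = 1.
Proof. by rewrite /nrm normr1. Qed.

End RealNormScale.

Section MeasureRing.
Variables (R : realType) (G : topGroupType).
Local Notation M := (measure_algebra R G).
Local Notation d := (@dirac_measure R G).

(** Both sides are iterated integrals in the same order, so the associativity of [G] under the
    integrals is all that enters; no exchange of integrals occurs. *)
Lemma convA : associative (@conv R G).
Proof.
move=> a b c; apply: dualP => u; rewrite -[LHS]/(a _) -[RHS]/(a _).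
congr (a _); apply: C0P => s; rewrite -[LHS]/(b _) -[RHS]/(b _).
congr (b _); apply: C0P => t; rewrite -[LHS]/(c _) -[RHS]/(c _).
by congr (c _); apply: C0P => x; rewrite /= mulgA.
Qed.

Lemma conv1m : left_id (d 1%g) (@conv R G).
Proof.
move=> a; apply: dualP => u; rewrite -[LHS]/(a (translate 1%g u)).
by congr (a _); apply: C0P => x; rewrite /= mul1g.
Qed.

Lemma convm1 : right_id (d 1%g) (@conv R G).
Proof.
move=> a; apply: dualP => u; rewrite -[LHS]/(a _).
by congr (a _); apply: C0P => x; rewrite /= mulg1.
Qed.

Lemma convDl : left_distributive (@conv R G) +%R.
Proof. by move=> a b c; apply: dualP. Qed.

Lemma convDr : right_distributive (@conv R G) +%R.
Proof.
move=> a b c; apply: dualP => u; rewrite -[LHS]/(a _) -[RHS]/(a _ + a _).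
by rewrite -linearD; congr (a _); apply: C0P.
Qed.

HB.instance Definition _ := GRing.Zmodule_isPzRing.Build M
  convA conv1m convm1 convDl convDr.

Implicit Types (mu nu : M) (a : R[i]) (g h : G) (u : C0 R G).

Lemma convE mu nu : conv mu nu = mu * nu. Proof. by []. Qed.

Lemma dirac1 : d 1%g = 1. Proof. by []. Qed.

Lemma measZl a mu nu : (a *: mu) * nu = a *: (mu * nu).
Proof. exact: dualP. Qed.

Lemma measZr a mu nu : mu * (a *: nu) = a *: (mu * nu).
Proof.
apply: dualP => u; rewrite -[LHS]/(mu _) -[RHS]/(a * mu _) -linearZ.
by congr (mu _); apply: C0P.
Qed.

Lemma diracM g h : d (g * h)%g = d g * d h.
Proof. exact: dualP. Qed.

Lemma measD mu nu u : (mu + nu) u = mu u + nu u. Proof. by []. Qed.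
Lemma measN mu u : (- mu) u = - mu u. Proof. by []. Qed.
Lemma measZ a mu u : (a *: mu) u = a * mu u. Proof. by []. Qed.
Lemma dirac_measE g mu u : (d g * mu) u = mu (translate g u). Proof. by []. Qed.

Lemma meas_sum (I : Type) (s : seq I) (F : I -> M) u :
  (\sum_(i <- s) F i) u = \sum_(i <- s) F i u.
Proof. by elim: s => [|i s IH]; rewrite ?big_nil// !big_cons measD IH. Qed.

Lemma le_nrm_meas mu u : nrm (mu u) <= nrm mu * nrm u.
Proof. by rewrite -lecR rmorphM /= -!nrmE; exact: le_dual_norm. Qed.

Lemma nrm_meas_le mu (C : R) : 0 <= C -> (forall u, nrm (mu u) <= C * nrm u) ->
  nrm mu <= C.
Proof.
move=> C0 h; rewrite -lecR -nrmE; apply: dual_norm_le; first by rewrite lecR.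
by move=> u; rewrite !nrmE -rmorphM /= lecR.
Qed.

Lemma nrm_measM mu nu : nrm (mu * nu) <= nrm mu * nrm nu.
Proof.
apply: nrm_meas_le => [|u]; first by rewrite mulr_ge0// nrm_ge0.
rewrite -[X in nrm X]/(mu _); apply: le_trans (le_nrm_meas _ _) _.
rewrite -mulrA ler_wpM2l ?nrm_ge0// -lecR rmorphM /= -!nrmE.
exact: norm_slice.
Qed.

Lemma nrm_dirac_le1 g : nrm (d g) <= 1.
Proof.
apply: nrm_meas_le => // u; rewrite mul1r -lecR -!nrmE; exact: le_C0_norm.
Qed.

Lemma C0_nrm_le u (C : R) : 0 <= C -> (forall x, nrm (u x) <= C) -> nrm u <= C.
Proof.
move=> C0 h; rewrite -lecR -nrmE; apply: C0_norm_le; first by rewrite lecR.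
by move=> u'; rewrite !nrmE lecR.
Qed.

Lemma le_C0_nrm u x : nrm (u x) <= nrm u.
Proof. by rewrite -lecR -!nrmE; exact: le_C0_norm. Qed.

Lemma nrm_meas_adherent mu (e : R) : 0 < e ->
  exists2 u, nrm u <= 1 & nrm mu - e < nrm (mu u).
Proof.
move=> e0; have [C _ hC] := dual_ball_bounded mu.
have e0' : (0 : R[i]) < e%:C%C by rewrite ltcR.
have [|u u1 hu] := supnorm_adherent _ hC e0'.
  by exists 0; rewrite /= normr0.
exists u; first by rewrite -lecR -nrmE.
by rewrite -ltcR rmorphB /= -!nrmE.
Qed.

Lemma starD mu nu : star (mu + nu) = star mu + star nu.
Proof. by apply: dualP => u; rewrite -[LHS]/((mu _ + nu _)^*) rmorphD. Qed.

Lemma starZ a mu : star (a *: mu) = a^* *: star mu.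
Proof. by apply: dualP => u; rewrite -[LHS]/((a * mu _)^*) rmorphM. Qed.

Lemma starN mu : star (- mu) = - star mu.
Proof. by apply: dualP => u; rewrite -[LHS]/((- mu _)^*) rmorphN. Qed.

Lemma starK mu : star (star mu) = mu.
Proof.
apply: dualP => u; rewrite /= conjCK; congr (mu _).
by apply: C0P => x; rewrite /= conjCK invgK.
Qed.

Lemma star_dirac g : star (d g) = d g^-1%g.
Proof. by apply: dualP => u; rewrite /= conjCK. Qed.

(* For two arbitrary measures this is Fubini's theorem; a Dirac factor makes it
   immediate. *)
Lemma star_diracM g mu : star (d g * mu) = star mu * d g^-1%g.
Proof.
apply: dualP => u; rewrite -[LHS]/((mu _)^*) -[RHS]/((mu _)^*).
by congr ((mu _)^*); apply: C0P => x; rewrite /= invgM.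
Qed.

Lemma star_Mdirac g mu : star (mu * d g) = d g^-1%g * star mu.
Proof. by rewrite -{1}[mu]starK -{1}[g]invgK -star_diracM starK. Qed.

End MeasureRing.

(** * Neumann series *)

Section Neumann.
Variables (R : realType) (G : topGroupType).
Local Notation M := (measure_algebra R G).

Lemma Re_le_nrm (z : R[i]) : `|complex.Re z| <= nrm z.
Proof.
rewrite /nrm norm_normc; case: z => a b /=.
by rewrite -(sqrtr_sqr a) ler_wsqrtr// lerDl sqr_ge0.
Qed.

Lemma Im_le_nrm (z : R[i]) : `|complex.Im z| <= nrm z.
Proof.
rewrite /nrm norm_normc; case: z => a b /=.
by rewrite -(sqrtr_sqr b) ler_wsqrtr// lerDr sqr_ge0.
Qed.

Lemma nrm_le_ReIm (z : R[i]) : nrm z <= `|complex.Re z| + `|complex.Im z|.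
Proof.
rewrite /nrm norm_normc; case: z => a b /=.
rewrite -[leRHS]ger0_norm ?addr_ge0// -sqrtr_sqr ler_wsqrtr// sqrrD.
by rewrite !real_normK ?num_real// -addrA addrCA lerDr mulrn_wge0// mulr_ge0.
Qed.

(** Real and imaginary parts converge absolutely by comparison with the geometric series, which
    reduces the claim to the completeness of [R]. *)
Lemma series_geometric_cvg (z : nat -> R[i]) (c r : R) : 0 <= r < 1 -> 0 <= c ->
  (forall n, nrm (z n) <= c * r ^+ n) -> exists l : R[i], series z @ \oo --> l.
Proof.
move=> /andP[r0 r1] c0 hz.
have key (f : R[i] -> R) : (forall x, `|f x| <= nrm x) -> cvgn (series (f \o z)).
  move=> hf; apply: normed_cvg.
  apply: (@series_le_cvg _ _ (geometric c r)) => [n|n|n|] /=.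
  - exact: normr_ge0.
  - by rewrite mulr_ge0// exprn_ge0.
  - exact: le_trans (hf _) (hz n).
  - by apply: is_cvg_geometric_series; rewrite ger0_norm.
have /cvg_ex[lr hr] := key _ Re_le_nrm.
have /cvg_ex[li hi] := key _ Im_le_nrm.
exists (lr +i* li)%C; apply/cvgrPdist_lt => e e0.
have e2 : 0 < complex.Re e / 2.
  by rewrite divr_gt0// -ltcR ge0_RReK// ltW.
move/cvgrPdist_lt: hr => /(_ _ e2) hr; move/cvgrPdist_lt: hi => /(_ _ e2) hi.
apply: filterS2 hr hi => n hr hi.
rewrite nrmE -(ge0_RReK (ltW e0)) ltcR; apply: le_lt_trans (nrm_le_ReIm _) _.
have -> : complex.Re ((lr +i* li)%C - series z n) =
   lr - series (@complex.Re R \o z) n.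
  by rewrite raddfB /= /series /= raddf_sum.
have -> : complex.Im ((lr +i* li)%C - series z n) =
   li - series (@complex.Im R \o z) n.
  by rewrite raddfB /= /series /= raddf_sum.
by rewrite [ltRHS]splitr; exact: ltrD.
Qed.

Lemma nrm_cvg_le (z : nat -> R[i]) (l : R[i]) (c : R) :
  z @ \oo --> l -> (forall n, nrm (z n) <= c) -> nrm l <= c.
Proof.
move=> hz hc; apply/ler_addgt0Pr => e e0.
have e0' : (0 : R[i]) < e%:C%C by rewrite ltcR.
move/cvgrPdist_lt: hz => /(_ _ e0') [n _ /(_ n (leqnn _))].
rewrite nrmE ltcR => h.
rewrite -(subrK (z n) l) addrC; apply: le_trans (ler_nrmD _ _) _.
by apply: lerD (hc n) (ltW h).
Qed.

Lemma nrm_exp (x : M) n : nrm (x ^+ n) <= nrm x ^+ n.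
Proof.
elim: n => [|n IH]; first by rewrite !expr0; exact: nrm_dirac_le1.
rewrite !exprS; apply: le_trans (nrm_measM _ _) _.
by rewrite ler_wpM2l ?nrm_ge0.
Qed.

(** The series of the powers of [x] is summed weakly: its value at each test function is a
    convergent scalar series, and the geometric bound makes the limit a bounded functional. *)
Lemma neumann_left (x : M) : nrm x < 1 -> exists y : M, y = 1 + y * x.
Proof.
move=> x1; set r := nrm x.
have r01 : 0 <= r < 1 by rewrite nrm_ge0.
have ex (u : C0 R G) : exists l : R[i], series (fun n => (x ^+ n) u) @ \oo --> l.
  apply: (series_geometric_cvg r01 (nrm_ge0 u)) => n.
  apply: le_trans (le_nrm_meas _ _) _.
  by rewrite mulrC ler_wpM2l ?nrm_ge0// nrm_exp.
pose f u := projT1 (cid (ex u)).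
have hf u : series (fun n => (x ^+ n) u) @ \oo --> f u := projT2 (cid (ex u)).
have uniq u l : series (fun n => (x ^+ n) u) @ \oo --> l -> f u = l.
  by move=> hl; apply: cvg_unique (hf u) hl; exact: norm_hausdorff.
have fl : linear f.
  move=> a u v; apply: uniq.
  have -> : series (fun n => (x ^+ n) (a *: u + v)) =
     (fun n => a *: series (fun n => (x ^+ n) u) n + series (fun n => (x ^+ n) v) n).
    apply/funext => n; rewrite /series /= scaler_sumr -big_split /=.
    by apply: eq_bigr => k _; rewrite linearP.
  by apply: cvgD; [apply: cvgZr|]; exact: hf.
have fb u : nrm (f u) <= (1 - r)^-1 * nrm u.
  apply: nrm_cvg_le (hf u) _ => n.
  apply: le_trans (ler_nrm_sum _ _ _) _.
  have -> : (1 - r)^-1 * nrm u = nrm u / (1 - r) by rewrite mulrC.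
  apply: (@le_trans _ _ (series (geometric (nrm u) r) n)).
    apply: ler_sum => k _; apply: le_trans (le_nrm_meas _ _) _.
    by rewrite mulrC ler_wpM2l ?nrm_ge0// nrm_exp.
  rewrite geometric_seriesE ?lt_eqF//= ler_wpM2r//.
    by rewrite invr_ge0 subr_ge0 ltW.
  by rewrite ler_piMr ?nrm_ge0// gerBl exprn_ge0 ?nrm_ge0.
have fd : f \in @dual_pred R (C0 R G).
  apply: (@bounded_dual_pred _ _ _ ((1 - r)^-1)%:C%C) => // [|u].
    by rewrite lecR invr_ge0 subr_ge0 ltW.
  by rewrite !nrmE -rmorphM lecR.
exists (MkDual fd : M); apply: dualP => u; rewrite measD.
rewrite -[LHS]/(f u) -[(_ * x) u]/(f (slice x u)) -[(1 : M) u]/(u 1%g).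
(* Since [(x ^+ k.+1) u = (x ^+ k) (slice x u)], the partial sums at [u], shifted by one, are [u 1]
   plus those at [slice x u]. *)
apply: uniq; rewrite -cvg_shiftS.
have -> : (fun n => series (fun n => (x ^+ n) u) n.+1) =
   (fun n => u 1%g + series (fun n => (x ^+ n) (slice x u)) n).
  apply/funext => n; rewrite /series /= big_nat_recl//=; congr (_ + _).
  by apply: eq_bigr => k _; rewrite exprSr.
by apply: cvgD; [exact: cvg_cst|exact: hf].
Qed.

Lemma neumann (x : M) : nrm x < 1 ->
  exists y : M, [/\ y * (1 - x) = 1, (1 - x) * y = 1 & nrm y <= (1 - nrm x)^-1].
Proof.
move=> x1; have [y hy] := neumann_left x1.
(* So far [y] is only a left inverse of [1 - x]. The commutator [z] satisfies [z = z * x], and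
   [nrm x < 1] forces it to vanish, which makes the inverse two-sided. *)
have yx : y * x = x * y.
  set z := y * x - x * y.
  suff /eqP : z = 0 by rewrite subr_eq0 => /eqP.
  have zx : z = z * x.
    rewrite mulrBl -mulrA -[x * y * x]mulrA -[y * x in RHS]/(y * x).
    have -> : y * (x * x) = y * x - x by rewrite {2}hy mulrDl mul1r mulrA addrC addKr.
    have -> : x * (y * x) = x * y - x by rewrite {2}hy mulrDr mulr1 addrC addKr.
    by rewrite opprB addrA subrK.
  apply/eqP; rewrite -normr_eq0 nrmE; apply/eqP; congr (_%:C%C); apply/eqP.
  rewrite eq_le nrm_ge0 andbT leNgt; apply/negP => z0.
  have : nrm z <= nrm z * nrm x by rewrite {1}zx nrm_measM.
  by rewrite ler_pMr// leNgt x1.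
have yb : nrm y <= (1 - nrm x)^-1.
  rewrite -[leRHS]mul1r ler_pdivlMr ?subr_gt0// mulrBr mulr1 lerBlDr {1}hy.
  apply: le_trans (ler_nrmD _ _) _; apply: lerD; first exact: nrm_dirac_le1.
  exact: nrm_measM.
have e1 : y * (1 - x) = 1 by rewrite mulrBr mulr1 {1}hy addrK.
by exists y; split=> //; rewrite mulrBl mul1r -yx -e1 mulrBr mulr1.
Qed.
End Neumann.

(** * Fubini's theorem on compact groups *)

Section PartitionOfUnity.
Variables (R : realType).

Lemma nrm_continuous (V : normedModType R[i]) : continuous (@nrm R V).
Proof.
move=> x; apply/cvgrPdist_lt => e e0.
have e0' : (0 : R[i]) < e%:C%C by rewrite ltcR.
have /cvgrPdist_lt/(_ _ e0') := @cvg_id _ (nbhs x).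
apply: filterS => y; rewrite nrmE ltcR; apply: le_lt_trans.
rewrite ler_norml ler_nrmB andbT lerNl opprB.
by apply: le_trans (ler_nrmB _ _) _; rewrite -nrmN opprB.
Qed.

Lemma real_complex_continuous : continuous (fun t : R => t%:C%C : R[i]).
Proof.
move=> x; apply/cvgrPdist_lt => e e0.
have e0' : 0 < complex.Re e by rewrite -ltcR ge0_RReK// ltW.
have /cvgrPdist_lt/(_ _ e0') := @cvg_id _ (nbhs x).
apply: filterS => y h; rewrite -rmorphB nrmE nrm_real -(ge0_RReK (ltW e0)).
by rewrite ltcR.
Qed.

Lemma compact_C0 (T : topologicalType) (f : T -> R[i]) :
  compact [set: T] -> continuous f -> f \in @C0_pred R T.
Proof.
by move=> cT cf; apply/C0_predP; split=> // e _; exists setT => // x; case.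
Qed.

(* The weights form a partition of unity subordinate to a finite cover of the
   compact space by sets on which [p] varies by less than [e]. *)
Lemma compact_range_approx (T : topologicalType) (V : normedModType R[i])
    (p : T -> V) (e : R) : compact [set: T] -> continuous p -> 0 < e ->
  exists s : seq (T * C0 R T),
    forall x, nrm (p x - \sum_(q <- s) q.2 x *: p q.1) <= e.
Proof.
move=> cT cp e0.
(* A tent function that is positive exactly where [p x] is within [e] of [p y]; normalised, these
   become the weights. *)
pose phi y x : R := Num.max 0 (e - nrm (p x - p y)).
have cphi y : continuous (phi y).
  have c0 : continuous (fun _ : T => 0 : R) by move=> x; exact: cvg_cst.
  suff c1 : continuous (fun x : T => e - nrm (p x - p y)).
    by move=> x; apply: (@continuous_max _ _ _ _ x); [exact: c0|exact: c1].
  move=> x; apply: cvgB; first exact: cvg_cst.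
  apply: (@cvg_comp _ _ _ (fun x => p x - p y) (@nrm R V)); last exact: nrm_continuous.
  by apply: cvgB; [exact: cp|exact: cvg_cst].
have phi0 y x : 0 <= phi y x by rewrite le_max lexx.
have [D cD] : exists D : seq T, forall x, exists2 y, y \in D & 0 < phi y x.
  (* The filter of finite lists ordered by inclusion: a near-covering for it turns the local choice
     of [y] into one list [D] that serves every [x]. *)
  pose F := filter_from setT (fun s0 : seq T => [set s : seq T | {subset s0 <= s}]).
  have FF : Filter F.
    apply: filter_from_filter; first by exists [::].
    move=> s1 s2 _ _; exists (s1 ++ s2) => // s ss.
    by split=> x xs; apply: ss; rewrite mem_cat xs ?orbT.
  have [|D _ /(_ D) cD] := (compact_near_coveringP _).1 cT _ F
    (fun s x => exists2 y, y \in s & 0 < phi y x) FF.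
    move=> x _; exists ([set z | 0 < phi x z], [set s : seq T | x \in s]); last first.
      by move=> [z s] /= [xz xs]; exists x.
    split => /=; last by exists [:: x] => // s; apply; rewrite mem_head.
    apply: (cphi x x [set t | 0 < t]); apply: open_nbhs_nbhs; split; first exact: open_gt.
    by rewrite /= /phi subrr nrm0 subr0 lt_max e0 orbT.
  by exists D => x; apply: cD.
pose Phi x := \sum_(y <- D) phi y x.
have cPhi : continuous Phi.
  rewrite /Phi; elim: (D) => [|y s IH].
    have -> : (fun x => \sum_(y <- [::]) phi y x) = (fun=> 0).
      by apply/funext => x; rewrite big_nil.
    by move=> x; exact: cvg_cst.
  have -> : (fun x => \sum_(y <- y :: s) phi y x) =
     (fun x => phi y x + \sum_(y <- s) phi y x).
    by apply/funext => x; rewrite big_cons.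
  by move=> x; apply: cvgD; [exact: cphi|exact: IH].
have Phi0 x : 0 < Phi x.
  have [y yD yx] := cD x.
  rewrite /Phi (big_rem y)//=; apply: ltr_pwDl => //.
  by apply: sumr_ge0 => z _; exact: phi0.
have comega y : (fun x => (phi y x / Phi x)%:C%C) \in @C0_pred R T.
  apply: compact_C0 => // x.
  apply: (@cvg_comp _ _ _ (fun x => phi y x / Phi x) (fun t : R => t%:C%C : R[i]));
    last exact: real_complex_continuous.
  apply: cvgM; first exact: cphi.
  by apply: cvgV; [rewrite gt_eqF // Phi0|exact: cPhi].
exists [seq (y, MkC0 (comega y)) | y <- D] => x.
rewrite big_map /=.
have sum1 : \sum_(y <- D) phi y x / Phi x = 1.
  by rewrite -mulr_suml -/(Phi x) divff // gt_eqF // Phi0.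
have -> : p x - \sum_(y <- D) (phi y x / Phi x)%:C%C *: p y =
   \sum_(y <- D) (phi y x / Phi x)%:C%C *: (p x - p y).
  under [RHS]eq_bigr do rewrite scalerBr.
  by rewrite sumrB -scaler_suml -rmorph_sum /= sum1 scale1r.
apply: le_trans (ler_nrm_sum _ _ _) _.
rewrite -[leRHS]mul1r -sum1 mulr_suml; apply: ler_sum => y _.
have w0 : 0 <= phi y x / Phi x by rewrite divr_ge0 ?phi0// ltW// Phi0.
rewrite nrmZ nrm_real ger0_norm//.
have [h|h] := leP (nrm (p x - p y)) e; first by rewrite ler_wpM2l.
have -> : phi y x = 0 by apply/max_idPl; rewrite subr_le0 ltW.
by rewrite !mul0r.
Qed.

End PartitionOfUnity.

Lemma C0_sumE (R : realType) (T : topologicalType) (I : Type) (s : seq I)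
  (F : I -> C0 R T) x : (\sum_(i <- s) F i) x = \sum_(i <- s) F i x.
Proof. by elim: s => [|i s IH]; rewrite ?big_nil// !big_cons -IH. Qed.

Lemma C0_sumZE (R : realType) (T : topologicalType) (I : Type) (s : seq I)
  (c : I -> R[i]) (F : I -> C0 R T) x :
  (\sum_(i <- s) c i *: F i) x = \sum_(i <- s) c i * F i x.
Proof. by rewrite C0_sumE. Qed.

Lemma C0_subE (R : realType) (T : topologicalType) (u v : C0 R T) x :
  (u - v) x = u x - v x.
Proof. by []. Qed.

Lemma dualB (R : realType) (V : normedModType R[i]) (mu : dual V) (u v : V) :
  mu (u - v) = mu u - mu v.
Proof. exact: raddfB. Qed.

Lemma dualZ (R : realType) (V : normedModType R[i]) (mu : dual V) (a : R[i]) (u : V) :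
  mu (a *: u) = a * mu u.
Proof. exact: linearZ. Qed.

Lemma dual_sumZ (R : realType) (V : normedModType R[i]) (mu : dual V) (I : Type)
    (s : seq I) (c : I -> R[i]) (F : I -> V) :
  mu (\sum_(i <- s) c i *: F i) = \sum_(i <- s) c i * mu (F i).
Proof.
elim: s => [|i s IH]; first by rewrite !big_nil raddf0.
by rewrite !big_cons -IH; exact: (dual_linear mu).
Qed.

Section CompactFubini.
Variables (R : realType) (H : topGroupType).
Hypothesis cH : compact [set: H].
Local Notation M := (measure_algebra R H).

(** The two sides are the conjugates of the integrals of [w (s * t)] in the two orders.
    Approximating [translate s w] uniformly in [s] by a finite sum of products brings both iterated
    integrals close to the same finite sum [I]. *)
Lemma star_convM (mu nu : M) : star (mu * nu) = star nu * star mu.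
Proof.
(* [g t] is the integral of [w (s * t)] over [s] with respect to [mu]; being a flipped slice, it is
   already known to lie in [C0]. *)
apply: dualP => u; set w := flip u; set g := flip (slice (star mu) u).
have gE t (v : C0 R H) : (forall s, v s = w (s * t)%g) -> g t = mu v.
  move=> vw; rewrite /= conjCK; congr (mu _); apply: C0P => s.
  by rewrite vw /= invgM.
rewrite -[LHS]/((mu (slice nu w))^*) -[RHS]/((nu g)^*); congr (_^*).
have right_tr t : exists v : C0 R H, forall s, v s = w (s * t)%g.
  have vP : (fun s => w (s * t)%g) \in @C0_pred R H.
    apply: compact_C0 => //; apply: continuous_C0; apply: continuous_mulg.
      exact: id_continuousg.
    exact: cst_continuousg.
  by exists (MkC0 vP).
apply/eqP; rewrite -subr_eq0 -normr_eq0 nrmE.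
suff : nrm (mu (slice nu w) - nu g) <= 0.
  by move=> h; apply/eqP; congr (_%:C%C); apply/le_anti; rewrite h nrm_ge0.
(* Each order of integration costs [nrm mu * nrm nu * e']; the summand [1] keeps the divisor
   positive. *)
pose c := 2 * nrm mu * nrm nu + 1.
have c0 : 0 < c by rewrite ltr_wpDl// !mulr_ge0// nrm_ge0.
apply/ler_addgt0Pr => e e0; rewrite add0r.
have [s hs] := compact_range_approx cH (@translate_continuous R H w)
  (divr_gt0 e0 c0).
set e' := e / c in hs.
have e'0 : 0 < e' by rewrite divr_gt0.
pose I := \sum_(q <- s) mu q.2 * nu (translate q.1 w).
have h1 : nrm (mu (slice nu w) - I) <= nrm mu * nrm nu * e'.
  have -> : I = mu (\sum_(q <- s) nu (translate q.1 w) *: q.2).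
    by rewrite dual_sumZ; apply: eq_bigr => q _; rewrite mulrC.
  rewrite -dualB; apply: le_trans (le_nrm_meas _ _) _.
  rewrite -mulrA ler_wpM2l ?nrm_ge0//.
  apply: C0_nrm_le => [|x]; first by rewrite mulr_ge0 ?nrm_ge0// ltW.
  have -> : (slice nu w - \sum_(q <- s) nu (translate q.1 w) *: q.2) x =
     nu (translate x w - \sum_(q <- s) q.2 x *: translate q.1 w).
    rewrite dualB dual_sumZ C0_subE C0_sumZE; congr (_ - _).
    by apply: eq_bigr => q _; rewrite mulrC.
  by apply: le_trans (le_nrm_meas _ _) _; rewrite ler_wpM2l ?nrm_ge0.
have h2 : nrm (nu g - I) <= nrm mu * nrm nu * e'.
  rewrite /I -dual_sumZ -dualB.
  apply: le_trans (le_nrm_meas _ _) _.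
  rewrite [nrm mu * _]mulrC -mulrA ler_wpM2l ?nrm_ge0//.
  apply: C0_nrm_le => [|t]; first by rewrite mulr_ge0 ?nrm_ge0// ltW.
  have [v hv] := right_tr t.
  have -> : (g - \sum_(q <- s) mu q.2 *: translate q.1 w) t =
     mu (v - \sum_(q <- s) w (q.1 * t)%g *: q.2).
    rewrite dualB dual_sumZ C0_subE C0_sumZE (gE t v hv); congr (_ - _).
    by apply: eq_bigr => q _; rewrite mulrC.
  apply: le_trans (le_nrm_meas _ _) _; rewrite ler_wpM2l ?nrm_ge0//.
  apply: C0_nrm_le => [|x]; first exact: ltW.
  have -> : (v - \sum_(q <- s) w (q.1 * t)%g *: q.2) x =
     (translate x w - \sum_(q <- s) q.2 x *: translate q.1 w) t.
    rewrite !C0_subE !C0_sumZE hv; congr (_ - _).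
    by apply: eq_bigr => q _; rewrite mulrC.
  exact: le_trans (le_C0_nrm _ _) (hs x).
rewrite -(subrK I (mu _)) -addrA -[I - _]opprB.
apply: le_trans (ler_nrmD _ _) _; rewrite nrmN.
apply: le_trans (lerD h1 h2) _; rewrite /e' -mulrDl mulrA.
rewrite ler_pdivrMr// mulrC ler_wpM2l ?(ltW e0)//.
by rewrite -mulr2n -mulr_natl mulrA lerDl.
Qed.
End CompactFubini.

(** * Haar measure of a compact subgroup *)

Section CompactHaar.
Variables (R : realType) (H : topGroupType).
Hypothesis cH : compact [set: H].
Local Notation M := (measure_algebra R H).

Lemma compact_supported (f : H -> R[i]) : continuous f -> compactly_supported f.
Proof. by move=> cf; split=> //; exists setT => // x []. Qed.

Lemma one_C0_subproof : (fun _ : H => 1 : R[i]) \in @C0_pred R H.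
Proof. by apply: compact_C0 => // x; exact: cvg_cst. Qed.

Definition one_C0 : C0 R H := MkC0 one_C0_subproof.

Section HaarFunctional.
Variable lam : (H -> R[i]) -> R[i].
Hypothesis lamP : is_haar lam.
Hypothesis lam1 : lam (fun=> 1) = 1.

Let cst_cs (c : R[i]) : compactly_supported (fun _ : H => c).
Proof. by apply: compact_supported => x; exact: cvg_cst. Qed.

Lemma haar_cst (c : R[i]) : lam (fun=> c) = c.
Proof.
have l0 : lam (fun=> 0) = 0.
  have := haar_linear lamP (-1) (cst_cs 0) (cst_cs 0).
  by rewrite mulr0 addr0 mulN1r addNr.
have := haar_linear lamP c (cst_cs 1) (cst_cs 0).
by rewrite l0 lam1 mulr1 !addr0.
Qed.

(** Multiplying [f] by the phase [w] makes the integral equal to [nrm (lam f)]. It is then the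
    integral of the real part of [w * f], which positivity bounds by [c]. *)
Lemma haar_nrm_le (f : H -> R[i]) (c : R) : continuous f ->
  (forall x, nrm (f x) <= c) -> nrm (lam f) <= c.
Proof.
move=> cf fc.
have re_le (g : H -> R[i]) : continuous g -> (forall x, g x <= c%:C%C) ->
    lam g <= c%:C%C.
  move=> cg gc; rewrite -subr_ge0 -{1}(haar_cst c%:C%C) -mulN1r addrC.
  rewrite -(haar_linear lamP _ (compact_supported cg) (cst_cs _)).
  apply: (haar_ge0 lamP) => [|x]; last by rewrite mulN1r addrC subr_ge0.
  apply: compact_supported => x; apply: cvgD; last exact: cvg_cst.
  by apply: cvgM; [exact: cvg_cst|exact: cg].
have c0 : 0 <= c := le_trans (nrm_ge0 _) (fc 1%g).
have [->|a0] := eqVneq (lam f) 0; first by rewrite nrm0.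
have na0 : nrm (lam f) != 0 by apply: contra_neq a0 => n0; apply/eqP; rewrite -normr_eq0 nrmE n0.
pose w := ((nrm (lam f))^-1)%:C%C * (lam f)^*.
have nw : nrm w = 1 by rewrite nrmM nrm_conj nrm_real normfV ger0_norm ?nrm_ge0// mulVf.
have wa : w * lam f = (nrm (lam f))%:C%C.
  rewrite /w -mulrA [_^* * _]mulrC -normCK nrmE -rmorphXn -rmorphM /=.
  by rewrite expr2 mulKf.
pose g x := w * f x.
have cg : continuous g by move=> x; apply: cvgM; [exact: cvg_cst|exact: cf].
have gle x : nrm (g x) <= c by rewrite nrmM nw mul1r.
have cpart (p : R[i] -> R) : (forall y z, p (y - z) = p y - p z) ->
  (forall z, `|p z| <= nrm z) -> continuous (fun x => (p (g x))%:C%C : R[i]).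
  move=> pB hp x; apply: (@cvg_comp _ _ _ (fun x => p (g x)) (fun t : R => t%:C%C : R[i]));
    last exact: real_complex_continuous.
  apply/cvgrPdist_lt => e e0.
  have e0' : (0 : R[i]) < e%:C%C by rewrite ltcR.
  have /cvgrPdist_lt/(_ _ e0') := cg x.
  by apply: filterS => y; rewrite nrmE ltcR -pB; apply: le_lt_trans.
have cr := cpart _ (@raddfB _ _ (@complex.Re R)) (@Re_le_nrm R).
have ci := cpart _ (@raddfB _ _ (@complex.Im R)) (@Im_le_nrm R).
have le_part (p : R[i] -> R) : (forall z, `|p z| <= nrm z) ->
  forall x, (p (g x))%:C%C <= c%:C%C.
  by move=> hp x; rewrite lecR; apply: le_trans (ler_norm _) _; exact: le_trans (hp _) _.
have lr := re_le _ cr (le_part _ (@Re_le_nrm R)).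
have li := re_le _ ci (le_part _ (@Im_le_nrm R)).
have : lam g = 'i%C * lam (fun x => (complex.Im (g x))%:C%C) +
   lam (fun x => (complex.Re (g x))%:C%C).
  rewrite -(haar_linear lamP _ (compact_supported ci) (compact_supported cr)).
  by congr lam; apply/funext => x; rewrite addrC; case: (g x) => a b; simpc.
have -> : lam g = (nrm (lam f))%:C%C.
  rewrite -wa -[RHS]addr0 -(haar_cst 0).
  rewrite -(haar_linear lamP _ (compact_supported cf) (cst_cs _)).
  by congr lam; apply/funext => x; rewrite addr0.
(* The order of [R[i]] relates only numbers with equal imaginary parts, so [li] says in particular
   that the integral of the imaginary part is real; times [i] it adds nothing to the real part. *)
move: lr li; case: (lam (fun x => (complex.Re _)%:C%C)) => a b.
case: (lam (fun x => (complex.Im _)%:C%C)) => a' b'.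
rewrite !lecE /= => /andP[_ ac] /andP[/eqP <- _]; simpc.
by move=> [-> _].
Qed.

Lemma haar_measure : exists mu : M,
  [/\ forall u, mu u = lam u, nrm mu <= 1, mu one_C0 = 1 &
      forall s, dirac_measure R s * mu = mu].
Proof.
have lamu (u : C0 R H) : nrm (lam u) <= 1 * nrm u.
  by rewrite mul1r; apply: haar_nrm_le => [|x];
    [exact: C0_continuous|exact: le_C0_nrm].
have cu (u : C0 R H) := compact_supported (@C0_continuous _ _ u).
have lamD : (fun u : C0 R H => lam u) \in @dual_pred R (C0 R H).
  apply: (@bounded_dual_pred _ _ _ 1) => // [a u v|u].
    exact: (haar_linear lamP a (cu u) (cu v)).
  by rewrite mul1r !nrmE lecR -[leRHS]mul1r.
exists (MkDual lamD : M); split=> //.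
- by apply: nrm_meas_le => // u; exact: lamu.
- by move=> s; apply: dualP => u; exact: (haar_translate lamP s (cu u)).
Qed.

End HaarFunctional.

Definition left_haar (mu : M) := mu one_C0 = 1 /\
  forall s, dirac_measure R s * mu = mu.

(** By left invariance [slice mu u] is the constant function [mu u]. *)
Lemma mul_left_haar (nu mu : M) : left_haar mu -> nu * mu = nu one_C0 *: mu.
Proof.
move=> [_ muL]; apply: dualP => u; rewrite -[LHS]/(nu (slice mu u)).
have -> : slice mu u = mu u *: one_C0.
  apply: C0P => s; rewrite -[LHS]/((dirac_measure R s * mu) u) muL.
  by rewrite -[RHS]/(mu u * 1) mulr1.
by rewrite dualZ mulrC.
Qed.

Lemma star_one_C0 (mu : M) : mu one_C0 = 1 -> star mu one_C0 = 1.
Proof.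
move=> mu1; rewrite -[LHS]/((mu (flip one_C0))^*).
have -> : flip one_C0 = one_C0 by apply: C0P => s; rewrite /= conjC1.
by rewrite mu1 conjC1.
Qed.

(* [star nu * mu] is [mu] by left invariance of [mu]; applying [star] turns it into
   [star mu * nu], which is [nu]. *)
Lemma star_left_haar (mu nu : M) : left_haar mu -> left_haar nu -> star mu = nu.
Proof.
move=> muL nuL; have : star (star nu * mu) = star mu * nu.
  by rewrite star_convM // starK.
rewrite (mul_left_haar (star nu) muL) (mul_left_haar (star mu) nuL).
by rewrite (star_one_C0 muL.1) (star_one_C0 nuL.1) !scale1r.
Qed.

Lemma left_haar_unique (mu nu : M) : left_haar mu -> left_haar nu -> mu = nu.
Proof.
by move=> muL nuL; rewrite -(star_left_haar muL muL) (star_left_haar muL nuL).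
Qed.

End CompactHaar.

Section HaarOfSubgroup.
Variables (R : realType) (G : topGroupType) (K : subgroup G).
Variable mK : measure_algebra R G.
Hypothesis cK : compact (subgroup_set K).
Hypothesis hK : normalised_haar K mK.
Local Notation Kt := (subgroup_type K).
Local Notation m := mK.
Local Notation d := (@dirac_measure R G).

Lemma subgroup_type_compact : compact [set: Kt].
Proof.
move=> F PF _; have cv := @subg_val_continuous G K.
have FK : ((@subg_val G K) @ F) (subgroup_set K).
  by apply: (@filterS _ F _ setT); [move=> x _; exact: subg_valP|exact: filterT].
have [k [Kk kF]] := cK (fmap_proper_filter (@subg_val G K) PF) FK.
exists (subg_mk Kk); split=> // A B FA [_ [[O oO <-] kO OB]].
have FA' : ((@subg_val G K) @ F) ((@subg_val G K) @` A).
  by apply: (@filterS _ F _ A) => // a Aa; exists a.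
have [_ [[a Aa <-] aO]] := kF _ O FA' (open_nbhs_nbhs (conj oO kO)).
by exists a; split=> //; exact: OB.
Qed.

Definition restrict_subgroup_subproof (u : G -> R[i]) (cu : continuous u) :
  (fun k : Kt => u (subg_val k)) \in @C0_pred R Kt.
Proof.
apply: compact_C0 => [|k]; first exact: subgroup_type_compact.
exact: (@cvg_comp _ _ _ (@subg_val G K) u _ _ _ (@subg_val_continuous G K k) (cu _)).
Qed.

Definition restrict_subgroup u cu : C0 R Kt := MkC0 (@restrict_subgroup_subproof u cu).

(** Transfers questions about [m] to the compact group [K], where Fubini's theorem and the
    uniqueness of Haar measure are available. *)
Lemma haar_on_subgroup : exists mu : measure_algebra R Kt,
  [/\ left_haar subgroup_type_compact mu, nrm mu <= 1 &
      forall u : C0 R G, m u = mu (restrict_subgroup (@C0_continuous _ _ u))].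
Proof.
have [lam [lamP lam1 mE]] := hK.
have [mu [muE nmu mu1 muL]] := haar_measure subgroup_type_compact lamP lam1.
by exists mu; split=> // u; rewrite mE muE.
Qed.

Lemma haar_le (u : C0 R G) (c : R) :
  (forall k, subgroup_set K k -> nrm (u k) <= c) -> nrm (m u) <= c.
Proof.
move=> uc; have c0 : 0 <= c := le_trans (nrm_ge0 _) (uc _ (subgroup1 K)).
have [mu [muL nmu ->]] := haar_on_subgroup.
apply: le_trans (le_nrm_meas _ _) _; rewrite -[leRHS]mul1r.
apply: ler_pM; rewrite ?nrm_ge0//; apply: C0_nrm_le => // k.
by apply: uc; exact: subg_valP.
Qed.

Lemma haar_const (u : C0 R G) (c : R[i]) :
  (forall k, subgroup_set K k -> u k = c) -> m u = c.
Proof.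
move=> uc; have [mu [[mu1 muL] _ ->]] := haar_on_subgroup.
have -> : restrict_subgroup (@C0_continuous _ _ u) = c *: one_C0 R subgroup_type_compact.
  by apply: C0P => k; rewrite /= uc; [rewrite -[RHS]/(c * 1) mulr1|exact: subg_valP].
by rewrite dualZ mu1 mulr1.
Qed.

Lemma nrm_haar_le1 : nrm m <= 1.
Proof.
apply: nrm_meas_le => // u; rewrite mul1r; apply: haar_le => k _.
exact: le_C0_nrm.
Qed.

Lemma dirac_haar k : subgroup_set K k -> d k * m = m.
Proof.
move=> Kk; apply: dualP => u; have [mu [[_ muL] _ mE]] := haar_on_subgroup.
rewrite dirac_measE !mE -{2}(muL (subg_mk Kk)) dirac_measE.
by congr (mu _); apply: C0P.
Qed.

Lemma haarM : m * m = m.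
Proof.
apply: dualP => u; apply: haar_const => k Kk.
by rewrite -[RHS](congr1 (fun nu : measure_algebra R G => nu u) (dirac_haar Kk)).
Qed.

Lemma star_haar : star m = m.
Proof.
apply: dualP => u; rewrite -[LHS]/((m (flip u))^*).
have [mu [muL _ mE]] := haar_on_subgroup.
rewrite !mE -{2}(star_left_haar muL muL) -[RHS]/((mu (flip _))^*).
by congr ((mu _)^*); apply: C0P.
Qed.

(** Conjugation by [g] is a continuous automorphism of [K]; the image [nu] of Haar measure under it
    is again left invariant and normalised, hence equal to Haar measure by uniqueness. *)
Lemma dirac_haar_comm g : normaliser_set K g -> d g * m = m * d g.
Proof.
move=> Ng; have [mu [muL nmu mE]] := haar_on_subgroup.
have /normaliser_setP Ng' := Ng.
pose cj (k : Kt) : Kt := subg_mk ((Ng' _).1 (subg_valP k)).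
have ccj : continuous cj.
  apply: continuous_subg; apply: continuous_mulg; last exact: cst_continuousg.
  apply: continuous_mulg; first exact: cst_continuousg.
  exact: subg_val_continuous.
have cjP (u : C0 R Kt) : (fun k => u (cj k)) \in @C0_pred R Kt.
  by apply: compact_C0 => [|]; [exact: subgroup_type_compact|exact: continuous_C0].
pose cu u := MkC0 (cjP u).
have nuP : (fun u => mu (cu u)) \in @dual_pred R (C0 R Kt).
  apply: (@bounded_dual_pred _ _ _ 1) => // [a u v|u].
    have -> : cu (a *: u + v) = a *: cu u + cu v by apply: C0P.
    exact: (dual_linear mu).
  rewrite mul1r !nrmE lecR; apply: le_trans (le_nrm_meas _ _) _.
  rewrite -[leRHS]mul1r; apply: ler_pM; rewrite ?nrm_ge0//.
  by apply: C0_nrm_le => [|k]; [exact: nrm_ge0|exact: (le_C0_nrm u (cj k))].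
pose nu : measure_algebra R Kt := MkDual nuP.
have nuL : left_haar subgroup_type_compact nu.
  split=> [|s].
    by rewrite -[LHS]/(mu _) -[RHS](muL.1); congr (mu _); apply: C0P.
  apply: dualP => u; rewrite -[LHS]/(mu _) -[RHS]/(mu _).
  (* Translating by [s] after conjugating is conjugating after translating by [g^-1 * s * g], which
     lies in [K]. *)
  have sP : subgroup_set K (g^-1 * subg_val s * g)%g.
    by apply: (Ng' _).2; rewrite !mulgA mulgV mul1g mulgK; exact: subg_valP.
  rewrite -[in RHS](muL.2 (subg_mk sP)) dirac_measE; congr (mu _).
  apply: C0P => k; rewrite -[LHS]/(u _) -[RHS]/(u _); congr (u _).
  apply: subg_val_inj; rewrite -[LHS]/(subg_val s * (g * subg_val k * g^-1))%g.
  rewrite -[RHS]/(g * (g^-1 * subg_val s * g * subg_val k) * g^-1)%g.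
  by rewrite !mulgA mulgV mul1g.
apply: dualP => u; rewrite dirac_measE -[RHS]/(m _) !mE.
rewrite -{2}(left_haar_unique nuL muL) -[RHS]/(mu _).
congr (mu _); apply: C0P => k; rewrite /= -[RHS]/(u _).
by rewrite mulgVK.
Qed.

End HaarOfSubgroup.

(** * Moebius unitaries *)

(** Serves the Lipschitz estimate for [mobius]: each summand on the right contains one of the
    differences [r - r'] and [s - t]. *)
Lemma mulrB1_telescope (A : pzRingType) (s t r r' : A) :
  (1 - s) * r - (1 - t) * r' = (r - r') - (s - t) * r - t * (r - r').
Proof.
rewrite !mulrBl mulrBr !mul1r -[RHS]addrA -opprD [s * r - _ + _]addrA subrK.
by rewrite !opprD !opprK addrACA.
Qed.

Section Mobius.
Variables (R : realType) (G : topGroupType).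
Local Notation M := (measure_algebra R G).
Local Notation d := (@dirac_measure R G).
Implicit Types (a b : R[i]) (g h : G) (mu nu v : M).

(** Antimultiplicativity of [star] on a general [G] is drawn from the case of a Dirac factor, which
    covers affine elements such as [1 - a *: d g]. *)
Lemma star_mul_fin v a g : star (v * (1 - a *: d g)) = (1 - a^* *: d g^-1%g) * star v.
Proof.
rewrite mulrBr mulr1 measZr starD starN starZ star_Mdirac.
by rewrite mulrBl mul1r measZl.
Qed.

Lemma star_fin_mul v a g : star ((1 - a *: d g) * v) = star v * (1 - a^* *: d g^-1%g).
Proof.
rewrite mulrBl mul1r measZl starD starN starZ star_diracM.
by rewrite mulrBr mulr1 measZr.
Qed.

Lemma nrm_measM_le mu nu (c e : R) : nrm mu <= c -> nrm nu <= e ->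
  nrm (mu * nu) <= c * e.
Proof.
by move=> h1 h2; apply: le_trans (nrm_measM _ _) _; apply: ler_pM; rewrite ?nrm_ge0.
Qed.

Lemma star1 : star (1 : M) = 1.
Proof. by rewrite -dirac1 star_dirac invg1. Qed.

Lemma nrm_Zdirac a g : nrm (a *: d g) <= nrm a.
Proof. by rewrite nrmZ ler_piMr ?nrm_ge0// nrm_dirac_le1. Qed.

(** The inverse of [1 - mu] as a total function; [1] is a default value outside the unit ball. *)
Definition resolvent mu : M :=
  if pselect (nrm mu < 1) is left h then projT1 (cid (neumann h)) else 1.

Lemma resolventP mu : nrm mu < 1 ->
  [/\ resolvent mu * (1 - mu) = 1, (1 - mu) * resolvent mu = 1 &
      nrm (resolvent mu) <= (1 - nrm mu)^-1].
Proof. by move=> h; rewrite /resolvent; case: pselect => // h'; case: cid. Qed.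

(* The Moebius transform [(1 - a z^-1) / (1 - a^* z)], unimodular for [|z| = 1],
   evaluated at the unitary [z = dirac_measure g]. *)
Definition mobius a g : M := (1 - a *: d g^-1%g) * resolvent (a^* *: d g).

Lemma resolvent_dirac a g : nrm a < 1 -> let r := resolvent (a^* *: d g) in
  [/\ r * (1 - a^* *: d g) = 1, (1 - a^* *: d g) * r = 1 & nrm r <= (1 - nrm a)^-1].
Proof.
move=> a1; have na : nrm (a^* *: d g) <= nrm a by rewrite -(nrm_conj a) nrm_Zdirac.
have [e1 e2 e3] := resolventP (le_lt_trans na a1).
split=> //; apply: le_trans e3 _.
by rewrite lef_pV2 ?posrE ?subr_gt0 ?(le_lt_trans na)// lerB.
Qed.

Lemma inverse_comm (x x' y : M) : x * x' = 1 -> x' * x = 1 -> x * y = y * x ->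
  x' * y = y * x'.
Proof.
by move=> e1 e2 c; rewrite -[LHS]mulr1 -e1 mulrA -[x' * y * x]mulrA -c mulrA e2 mul1r.
Qed.

Lemma fin_comm mu a g : d g * mu = mu * d g ->
  (1 - a *: d g) * mu = mu * (1 - a *: d g).
Proof. by move=> c; rewrite mulrBl mulrBr mul1r mulr1 measZl measZr c. Qed.

(** With [p = 1 - a^* z] and [q = 1 - a z^-1] one has [star p = q], so [q * r] is formally unitary,
    where [r] inverts [p]. All factors commute with [m], and the products collapse to [star v * v]
    and [v * star v]. *)
Lemma local_unitary_mobius m v a g : nrm a < 1 ->
  d g * m = m * d g -> d g^-1%g * m = m * d g^-1%g ->
  local_unitary m v -> local_unitary m (v * mobius a g).
Proof.
move=> a1 mg mg' [vv1 vv2]; have [rp pr _] := resolvent_dirac g a1.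
rewrite /local_unitary /= !convE in vv1 vv2 *; rewrite /mobius.
set r := resolvent _ in rp pr *; set p := 1 - a^* *: d g in rp pr *.
set q := 1 - a *: d g^-1%g; set s := star r.
have qs : q * s = 1 by rewrite /q -[a]conjCK -star_mul_fin rp star1.
have sq : s * q = 1 by rewrite /q -[a]conjCK -star_fin_mul pr star1.
have pq : p * q = q * p.
  apply/esym/fin_comm; rewrite /p mulrBl mulrBr mul1r mulr1 measZl measZr.
  by rewrite -!diracM mulgV mulVg.
have sy : star (v * (q * r)) = s * p * star v.
  (* The star of a product with the infinite series [r] is avoided: multiplying by [q] under [star]
     supplies the factor [p], which cancels [r]. Then [s] removes [q]. *)
  have e : q * star (v * (q * r)) = p * star v.
    rewrite {1}/q -[a in LHS]conjCK -star_mul_fin -/p -!mulrA rp mulr1.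
    by rewrite star_mul_fin invgK.
  by rewrite -[LHS]mul1r -sq -mulrA e mulrA.
have rq : r * q = q * r := inverse_comm pr rp pq.
have mp : p * m = m * p := fin_comm _ mg.
rewrite sy; split.
  have rm : r * m = m * r := inverse_comm pr rp mp.
  have qm : q * m = m * q by exact: fin_comm.
  rewrite -!mulrA [star v * _]mulrA vv1 (mulrA m) -qm -mulrA -rm.
  by rewrite [p * _]mulrA pq -mulrA [s * _]mulrA sq mul1r mulrA pr mul1r.
rewrite -!mulrA -[RHS]vv2; congr (v * _).
by rewrite !mulrA -rq -[r * q * s]mulrA qs mulr1 rp mul1r.
Qed.

Lemma mobius0 g : mobius 0 g = 1.
Proof.
have [|e _ _] := @resolvent_dirac 0 g; first by rewrite nrm0.
by move: e; rewrite /mobius conjC0 !scale0r subr0 mulr1 mul1r.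
Qed.

Lemma mobius_expansion a g : nrm a = 1 / 4 ->
  nrm (mobius a g - (1 + a^* *: d g - a *: d g^-1%g)) <= 1 / 6.
Proof.
move=> na; have a1 : nrm a < 1 by rewrite na; lra.
have [_ pr nr] := resolvent_dirac g a1; rewrite /mobius.
set r := resolvent _ in pr nr *; set x := a^* *: d g in pr *; set y := a *: _.
have nx : nrm x <= 1 / 4 by rewrite -na -(nrm_conj a) nrm_Zdirac.
have ny : nrm y <= 1 / 4 by rewrite -na nrm_Zdirac.
have rE : r = 1 + x * r by rewrite -{1}pr mulrBl mul1r subrK.
(* The remainder after the first order. As [nrm r <= 4 / 3], its three terms have norm at most
   [1/12], [1/16] and [1/48], with sum [1/6]. *)
have -> : (1 - y) * r - (1 + x - y) = x * (x * r) - y * x - y * (x * (x * r)).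
  have rE2 : r = 1 + x + x * (x * r) by rewrite {1}rE {1}rE mulrDr mulr1 addrA.
  rewrite mulrBl mul1r; have -> : y * r = y + (y * x + y * (x * (x * r))).
    by rewrite {1}rE2 !mulrDr mulr1 addrA.
  rewrite {1}rE2 opprB [y - _]addrC addrACA [1 + x + _ - _]addrC addKr.
  by rewrite opprD [_ + y]addrC addNKr opprD addrA.
have nr' : nrm r <= 4 / 3.
  by apply: le_trans nr _; rewrite -[leRHS]invf_div lef_pV2 ?posrE; lra.
have h1 : nrm (x * (x * r)) <= 1 / 4 * (1 / 4 * (4 / 3)).
  exact: nrm_measM_le nx (nrm_measM_le nx nr').
have h2 := nrm_measM_le ny h1; have h3 := nrm_measM_le ny nx.
apply: le_trans (ler_nrmD _ _) _; rewrite nrmN.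
have := ler_nrmD (x * (x * r)) (- (y * x)); rewrite nrmN.
by lra.
Qed.

Lemma mobius_lipschitz a b g : nrm a <= 1 / 4 -> nrm b <= 1 / 4 ->
  nrm (mobius a g - mobius b g) <= 4 * nrm (a - b).
Proof.
move=> na nb; rewrite /mobius.
have [|_ pra nra] := @resolvent_dirac a g; first lra.
have [|rpb prb nrb] := @resolvent_dirac b g; first lra.
set r := resolvent _ in pra nra *; set r' := resolvent _ in rpb prb nrb *.
have nr : nrm r <= 4 / 3.
  by apply: le_trans nra _; rewrite -[leRHS]invf_div lef_pV2 ?posrE; lra.
have nr' : nrm r' <= 4 / 3.
  by apply: le_trans nrb _; rewrite -[leRHS]invf_div lef_pV2 ?posrE; lra.
(* The resolvent identity. It bounds [r - r'] by [16/9] times [nrm (a - b)]; the other two terms add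
   [4/3] and [4/9], and the total [32/9] is below [4]. *)
have e : r - r' = r' * ((a - b)^* *: d g) * r.
  have -> : (a - b)^* *: d g = (1 - b^* *: d g) - (1 - a^* *: d g).
    by rewrite opprB [RHS]addrC addrA subrK rmorphB scalerBl.
  by rewrite mulrBr rpb mulrBl mul1r -mulrA pra mulr1.
rewrite mulrB1_telescope -scalerBl.
have dab h : nrm ((a - b) *: d h) <= nrm (a - b) := nrm_Zdirac _ _.
have h1 : nrm (r - r') <= 4 / 3 * nrm (a - b) * (4 / 3).
  rewrite e; apply: nrm_measM_le nr; apply: nrm_measM_le nr' _.
  by rewrite -nrm_conj nrm_Zdirac.
have h2 := nrm_measM_le (dab g^-1%g) nr.
have h3 := nrm_measM_le (le_trans (nrm_Zdirac b g^-1%g) nb) h1.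
apply: le_trans (ler_nrmD _ _) _; rewrite nrmN.
have := ler_nrmD (r - r') (- ((a - b) *: d g^-1%g * r)); rewrite nrmN.
move: h1 h2 h3 (nrm_ge0 (a - b)); clear.
move: (nrm (a - b)) (nrm _) (nrm _) (nrm _) (nrm _) => *; lra.
Qed.
End Mobius.

(** * Norm-continuous paths of local unitaries *)

Section UnitaryPaths.
Variables (R : realType) (G : topGroupType).
Local Notation M := (measure_algebra R G).
Local Notation d := (@dirac_measure R G).

(** Shrinking the parameter to [t * a], with [t] in [[0, 1]], gives a path of local unitaries from
    [v] to [v * mobius a g]; it is norm continuous by [mobius_lipschitz]. *)
Lemma connected_mobius (m v : M) (a : R[i]) (g : G) : nrm a <= 1 / 4 ->
  d g * m = m * d g -> d g^-1%g * m = m * d g^-1%g ->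
  connected_component (local_unitary m) m v ->
  connected_component (local_unitary m) m (v * mobius a g).
Proof.
move=> na mg mg' mv; apply: connected_component_trans (mv) _.
have vU := connected_component_sub mv.
have nta (t : R) : `[0, 1]%classic t -> nrm (t%:C%C * a) <= 1 / 4.
  rewrite /= in_itv /= => /andP[t0 t1]; rewrite nrmM nrm_real ger0_norm//.
  by apply: le_trans na; rewrite ler_piMl ?nrm_ge0.
pose f (t : R) : M := v * mobius (t%:C%C * a) g.
exists (f @` `[0, 1]); last first.
  by exists 1; rewrite /f ?mul1r//= in_itv /= lexx ler01.
split.
- by exists 0; rewrite /f ?mul0r ?mobius0 ?mulr1//= in_itv /= lexx ler01.
- move=> _ [t t01 <-]; apply: local_unitary_mobius => //.
  by apply: le_lt_trans (nta _ t01) _; lra.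
apply: connected_continuous_connected; first exact: segment_connected.
apply/subspace_continuousP => s s01; apply/cvgrPdist_lt => e e0.
have e0' : 0 < complex.Re e by rewrite -ltcR ge0_RReK// ltW.
pose c := nrm v * 4 + 1.
have c0 : 0 < c by rewrite ltr_wpDl// mulr_ge0// nrm_ge0.
have /cvgrPdist_lt/(_ _ (divr_gt0 e0' c0)) := @cvg_id _ (nbhs s).
rewrite /within /=; apply: filterS => t st t01.
rewrite nrmE -(ge0_RReK (ltW e0)) ltcR /f -mulrBr.
apply: le_lt_trans (nrm_measM _ _) _.
have h := mobius_lipschitz g (nta _ s01) (nta _ t01).
have h' : nrm (s%:C%C * a - t%:C%C * a) <= `|s - t|.
  rewrite -mulrBl -rmorphB nrmM nrm_real ler_piMr//.
  by apply: le_trans na _; lra.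
have {}h : nrm (mobius (s%:C%C * a) g - mobius (t%:C%C * a) g) <= 4 * `|s - t|.
  by apply: le_trans h _; rewrite ler_wpM2l.
apply: le_lt_trans (ler_wpM2l (nrm_ge0 _) h) _.
rewrite mulrA; apply: (@le_lt_trans _ _ (c * `|s - t|)).
  by rewrite ler_wpM2r// lerDl.
by rewrite mulrC -ltr_pdivlMr.
Qed.

End UnitaryPaths.

(** * Norm approximation by finite combinations of cosets *)

Section Approximation.
Variables (R : realType) (G : topGroupType) (K : subgroup G).
Variable mK : measure_algebra R G.
Hypothesis cK : compact (subgroup_set K).
Hypothesis hK : normalised_haar K mK.
Local Notation m := mK.
Local Notation M := (measure_algebra R G).
Local Notation d := (@dirac_measure R G).
Local Notation N := (normaliser_set K).

Definition coset_combination (s : seq (R[i] * G)) : M :=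
  \sum_(p <- s) p.1 *: (d p.2 * m).

(** The norm closure of the span of the [d g * m]. Growth is proved for finite combinations, while
    Moebius factors only keep elements within this closure. *)
Definition approximable (v : M) := forall e : R, 0 < e ->
  exists2 s : seq (R[i] * G), (forall p, p \in s -> N p.2) &
    nrm (v - coset_combination s) <= e.

Lemma approximable_haar : approximable m.
Proof.
move=> e e0; exists [:: (1, 1%g)].
  by move=> p; rewrite inE => /eqP ->; exact: normaliser1.
rewrite /coset_combination big_seq1 scale1r dirac1 mul1r subrr nrm0.
exact: ltW.
Qed.

Lemma approximableD v w : approximable v -> approximable w -> approximable (v + w).
Proof.
move=> hv hw e e0; have e2 : 0 < e / 2 by rewrite divr_gt0.
have [s sN vs] := hv _ e2; have [t tN wt] := hw _ e2.
exists (s ++ t) => [p|]; first by rewrite mem_cat => /orP[/sN|/tN].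
rewrite /coset_combination big_cat /= opprD addrACA.
by apply: le_trans (ler_nrmD _ _) _; rewrite [leRHS]splitr; exact: lerD.
Qed.

Lemma approximableZ a v : approximable v -> approximable (a *: v).
Proof.
move=> hv e e0; pose c := nrm a + 1.
have c0 : 0 < c by rewrite ltr_wpDl// nrm_ge0.
have [s sN vs] := hv _ (divr_gt0 e0 c0).
exists [seq (a * p.1, p.2) | p <- s] => [p /mapP[q /sN qN ->]//|].
rewrite /coset_combination big_map /=.
under eq_bigr do rewrite -scalerA.
rewrite -scaler_sumr -scalerBr nrmZ.
apply: le_trans (ler_wpM2l (nrm_ge0 _) vs) _.
by rewrite mulrCA ler_piMr ?(ltW e0)// ler_pdivrMr// mul1r lerDl.
Qed.

Lemma coset_combination_dirac s g : N g ->
  coset_combination s * d g = coset_combination [seq (p.1, (p.2 * g)%g) | p <- s].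
Proof.
move=> Ng; rewrite /coset_combination big_map mulr_suml; apply: eq_bigr => p _ /=.
by rewrite measZl diracM -!mulrA (dirac_haar_comm cK hK Ng).
Qed.

Lemma approximable_dirac v g : N g -> approximable v -> approximable (v * d g).
Proof.
move=> Ng hv e e0; have [s sN vs] := hv _ e0.
exists [seq (p.1, (p.2 * g)%g) | p <- s] => [p /mapP[q /sN qN ->]|].
  exact: normaliserM.
rewrite -coset_combination_dirac// -mulrBl -[e]mulr1.
exact: nrm_measM_le vs (nrm_dirac_le1 _ _).
Qed.

Lemma approximable_limit v : (forall e : R, 0 < e ->
    exists2 w, approximable w & nrm (v - w) <= e) -> approximable v.
Proof.
move=> hv e e0; have e2 : 0 < e / 2 by rewrite divr_gt0.
have [w hw vw] := hv _ e2; have [s sN ws] := hw _ e2.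
exists s => //; rewrite -(subrK w v) -addrA.
by apply: le_trans (ler_nrmD _ _) _; rewrite [leRHS]splitr; exact: lerD.
Qed.

Lemma approximable_mobius v a g : nrm a < 1 -> N g ->
  approximable v -> approximable (v * mobius a g).
Proof.
move=> a1 Ng hv; rewrite /mobius mulrA.
have {}hv : approximable (v * (1 - a *: d g^-1%g)).
  rewrite mulrBr mulr1 measZr -scaleNr; apply: approximableD => //.
  by apply: approximableZ; apply: approximable_dirac => //; exact: normaliserV.
set w := v * _ in hv *.
have [rp _ _] := resolvent_dirac g a1; set x := a^* *: d g in rp *.
set r := resolvent x in rp *.
have nx : nrm x <= nrm a by rewrite -(nrm_conj a) nrm_Zdirac.
have rE : r = 1 + r * x by rewrite -{1}rp mulrBr mulr1 subrK.
(* The geometric series with its exact remainder: the error [w * r * x ^+ n] is controlled by norms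
   alone. *)
have rn n : r = \sum_(k < n) x ^+ k + r * x ^+ n.
  elim: n => [|n IH]; first by rewrite big_ord0 add0r mulr1.
  rewrite big_ord_recr /= exprS mulrA -addrA {1}IH; congr (_ + _).
  by rewrite {1}rE mulrDl mul1r.
have wx n : approximable (w * x ^+ n).
  elim: n => [|n IH]; first by rewrite mulr1.
  rewrite exprSr mulrA measZr; apply: approximableZ.
  exact: approximable_dirac.
apply: approximable_limit => e e0.
have [n hn] : exists n, nrm w * nrm r * nrm a ^+ n <= e.
  have := @cvg_geometric R (nrm w * nrm r) (nrm a).
  rewrite ger0_norm ?nrm_ge0// => /(_ a1)/cvgrPdist_le/(_ _ e0)[n _ /(_ n (leqnn n))].
  rewrite sub0r normrN ger0_norm; last by rewrite geometric_ge0 ?mulr_ge0 ?nrm_ge0.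
  by exists n.
exists (w * \sum_(k < n) x ^+ k).
  rewrite mulr_sumr; elim/big_ind : _ => //; last exact: approximableD.
  by rewrite -[0](scale0r m); apply: approximableZ; exact: approximable_haar.
rewrite -mulrBr {1}(rn n) addrC addKr; apply: le_trans hn.
rewrite -mulrA; apply: nrm_measM_le => //; apply: nrm_measM_le => //.
apply: le_trans (nrm_exp _ _) _.
by rewrite lerXn2r ?nnegrE ?nrm_ge0.
Qed.

Lemma Gamma_sub_local_unitary : Gamma_group K m `<=` local_unitary m.
Proof.
move=> _ [z [g [z1 Ng ->]]]; rewrite /local_unitary /= !convE.
have Ng' := normaliserV Ng.
have zz : z^* * z = 1 by rewrite mulrC -normCK z1 expr1n.
rewrite measZl starZ star_diracM (star_haar cK hK).
rewrite !measZl !measZr !scalerA zz [z * _]mulrC zz !scale1r.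
have mm := haarM cK hK.
split; first by rewrite -!mulrA [d _ * (d _ * _)]mulrA -diracM mulVg dirac1 mul1r.
rewrite mulrA -[d g * m * m]mulrA mm (dirac_haar_comm cK hK Ng).
by rewrite -mulrA -diracM mulgV dirac1 mulr1.
Qed.

Lemma Gamma_nrm_le1 nu : Gamma_group K m nu -> nrm nu <= 1.
Proof.
move=> [z [g [z1 _ ->]]]; rewrite convE -[1]mulr1.
apply: nrm_measM_le; last exact: nrm_haar_le1 hK.
by apply: le_trans (nrm_Zdirac _ _) _; rewrite /nrm z1.
Qed.

End Approximation.

(** * Interpolation on finitely many cosets *)

Section ContinuityTools.
Variables (R : realType) (T : topologicalType).
Implicit Types (f : T -> R[i]) (p : T -> R).

Lemma continuous_realC p : continuous p -> continuous (fun y => (p y)%:C%C : R[i]).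
Proof.
move=> cp y; apply: (@cvg_comp _ _ _ p (fun t : R => t%:C%C : R[i])); first exact: cp.
exact: real_complex_continuous.
Qed.

Lemma continuous_interpolate f p (c : R[i]) : continuous f -> continuous p ->
  continuous (fun y => f y + (p y)%:C%C * (c - f y)).
Proof.
move=> cf cp y; apply: cvgD; first exact: cf.
apply: cvgM; first exact: continuous_realC.
by apply: cvgB; [exact: cvg_cst|exact: cf].
Qed.

Lemma continuous_clip f : continuous f ->
  continuous (fun y => ((Num.max 1 (nrm (f y)))^-1)%:C%C * f y).
Proof.
move=> cf y; apply: cvgM; last exact: cf.
apply: continuous_realC => x; apply: cvgV.
  by rewrite gt_eqF// lt_max ltr01.
apply: (@continuous_max _ _ (fun=> 1) (fun y => nrm (f y)) x); first exact: cvg_cst.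
by apply: (@cvg_comp _ _ _ f (@nrm R R[i])); [exact: cf|exact: nrm_continuous].
Qed.

End ContinuityTools.

Section Interpolation.
Variables (R : realType) (G : topGroupType) (K : subgroup G).
Hypothesis hG : hausdorff_space G.
Hypothesis lG : locally_compact [set: G].
Hypothesis cK : compact (subgroup_set K).
Local Notation opc := (one_point_compactification G).

Lemma C0_one_point (f : opc -> R[i]) : continuous f -> f None = 0 ->
  (fun x : G => f (Some x)) \in @C0_pred R G.
Proof.
move=> cf f0; apply/C0_predP; split=> [x|e e0].
  by move=> U nU; exact: (cf (Some x) U nU).
have /cvgrPdist_lt/(_ _ e0) := cf None.
rewrite f0 => -[C [cC _] CP]; exists C => // x nCx.
have /= := CP (Some x) _; rewrite sub0r normrN; apply.
by left; exists x.
Qed.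

Lemma compact_cosets (s : seq G) :
  compact [set x | exists2 h, h \in s & subgroup_set K (h^-1 * x)%g].
Proof.
elim: s => [|h s IH].
  suff -> : [set x | exists2 h, h \in [::] & subgroup_set K (h^-1 * x)%g] = set0.
    exact: compact0.
  by apply/seteqP; split=> // x [].
have -> : [set x | exists2 h', h' \in h :: s & subgroup_set K (h'^-1 * x)%g] =
   (fun k => h * k)%g @` K `|`
   [set x | exists2 h', h' \in s & subgroup_set K (h'^-1 * x)%g].
  apply/seteqP; split=> x.
    move=> [h']; rewrite inE => /orP[/eqP->|h's] Kx; last by right; exists h'.
    by left; exists (h^-1 * x)%g => //; rewrite mulVKg.
  move=> [[k Kk <-]|[h' h's Kx]]; first by exists h; rewrite ?mem_head ?mulKg.
  by exists h' => //; rewrite inE h's orbT.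
apply: compactU => //; apply: compact_image cK; apply: continuous_mulg.
  exact: cst_continuousg.
exact: id_continuousg.
Qed.

(** The one-point compactification is compact Hausdorff, hence normal, and Urysohn's lemma applies
    there. Adjoining [None] to [B] makes the function vanish at infinity. *)
Lemma opc_urysohn (A B : set G) : compact A -> compact B -> A `&` B = set0 ->
  exists f : opc -> R, [/\ continuous f, f None = 0,
    forall x, A x -> f (Some x) = 1 & forall x, B x -> f (Some x) = 0].
Proof.
move=> cA cB AB.
have hO : hausdorff_space opc by exact: one_point_compactification_hausdorff.
have nO : normal_space opc.
  by apply: compact_normal => //; exact: one_point_compactification_compact.
have cS (C : set G) : compact C -> compact (Some @` C : set opc).
  by move=> cC; apply: compact_image cC; exact: one_point_compactification_some_continuous.
pose B' : set opc := Some @` B `|` [set None].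
have cB' : closed B'.
  by apply: compact_closed => //; apply: compactU; [exact: cS|exact: compact_set1].
have cA' : closed (Some @` A : set opc) by apply: compact_closed => //; exact: cS.
have BA : B' `&` (Some @` A) = set0.
  apply/seteqP; split=> // -[x|] [].
    move=> [[y By [<-]]|//] [z Az [zy]].
    have : (A `&` B) y by split=> //; rewrite -zy.
    by rewrite AB.
  by move=> _ [].
have /normal_separatorP := nO => /(_ R _ _ cB' cA' BA).
move=> /(uniform_separatorP (R := R))[f [cf _ f0 f1]]; exists f; split=> //.
- by apply: f0; exists None => //; right.
- by move=> x Ax; apply: f1; exists (Some x) => //; exists x.
- by move=> x Bx; apply: f0; exists (Some x) => //; left; exists x.
Qed.

(** Induction on the list. If the coset of [h] is new, the previous [f] is corrected by a Urysohn
    function that is [1] on that coset and [0] on the earlier ones; otherwise [f] already has the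
    right values there. *)
Lemma interpolation_opc (w : G -> R[i]) (s : seq G) :
  (forall h h', subgroup_set K (h^-1 * h')%g -> w h = w h') ->
  exists f : opc -> R[i], [/\ continuous f, f None = 0 &
    forall h, h \in s -> forall x, subgroup_set K (h^-1 * x)%g -> f (Some x) = w x].
Proof.
move=> wK; elim: s => [|h s [f [cf f0 fs]]].
  exists (fun=> 0); split=> // x; exact: (@cst_continuous opc R[i] 0).
have [[h' h's Kh]|nh] := pselect (exists2 h', h' \in s & subgroup_set K (h'^-1 * h)%g).
  exists f; split=> // h1; rewrite inE => /orP[/eqP->|/fs//] x Kx.
  have := subgroupM Kh Kx; rewrite mulgA mulgK; exact: fs.
have [|p [cp p0 p1 p2]] := opc_urysohn (@compact_cosets [:: h]) (@compact_cosets s).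
  apply/seteqP; split=> // x [[h1]]; rewrite inE => /eqP -> Kx [h' h's Kx'].
  apply: nh; exists h' => //.
  by have := subgroupM Kx' (subgroupV Kx); rewrite invgM invgK mulgA mulgK.
exists (fun y => f y + (p y)%:C%C * (w h - f y)); split=> [||h1].
- exact: (@continuous_interpolate R opc).
- by rewrite f0 p0 mul0r addr0.
- rewrite inE => /orP[/eqP->|h1s] x Kx.
    rewrite p1; last by exists h; rewrite ?mem_head.
    by rewrite mul1r addrC subrK; exact: wK.
  by rewrite p2 ?mul0r ?addr0; [exact: (fs _ h1s)|exists h1].
Qed.

Lemma interpolation (w : G -> R[i]) (s : seq G) :
  (forall h h', subgroup_set K (h^-1 * h')%g -> w h = w h') ->
  (forall h, nrm (w h) <= 1) ->
  exists2 u : C0 R G, nrm u <= 1 &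
    forall h, h \in s -> forall k, subgroup_set K k -> u (h * k)%g = w h.
Proof.
move=> wK w1; have [f [cf f0 fs]] := interpolation_opc s wK.
(* Dividing by [M] clips [f] to the unit disc and leaves the prescribed values, of modulus at most
   [1], unchanged. *)
pose M y : R := Num.max 1 (nrm (f y)).
have M1 y : 1 <= M y by rewrite le_max lexx.
have M0 y : 0 < M y := lt_le_trans ltr01 (M1 y).
have gP : (fun x : G => ((M (Some x))^-1)%:C%C * f (Some x)) \in @C0_pred R G.
  apply: (@C0_one_point (fun y => ((M y)^-1)%:C%C * f y)); last by rewrite f0 mulr0.
  exact: (@continuous_clip R opc).
exists (MkC0 gP) => [|h hs k Kk].
  apply: C0_nrm_le => // x; rewrite /= nrmM nrm_real ger0_norm ?invr_ge0 ?(ltW (M0 _))//.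
  by rewrite mulrC ler_pdivrMr// mul1r le_max lexx orbT.
have Kx : subgroup_set K (h^-1 * (h * k))%g by rewrite mulKg.
rewrite /= /M (fs _ hs _ Kx) -(wK _ _ Kx).
have -> : Num.max 1 (nrm (w h)) = 1 by apply/max_idPl.
by rewrite invr1 mul1r.
Qed.

End Interpolation.

(** * Growth of norms *)

Section Growth.
Variables (R : realType) (G : topGroupType) (K : subgroup G).
Variable mK : measure_algebra R G.
Hypothesis hG : hausdorff_space G.
Hypothesis lG : locally_compact [set: G].
Hypothesis cK : compact (subgroup_set K).
Hypothesis hK : normalised_haar K mK.
Local Notation m := mK.
Local Notation M := (measure_algebra R G).
Local Notation d := (@dirac_measure R G).
Local Notation N := (normaliser_set K).

(* By the parallelogram inequality [2 |X| <= |X - Y| + |X + Y|] one of [1/4] and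
   [i/4] works. *)
Lemma mobius_parameter (X Y : R[i]) : exists2 a : R[i], nrm a = 1 / 4 &
  1 / 4 * nrm X <= nrm (a^* * X - a * Y).
Proof.
pose q : R[i] := (1 / 4)%:C%C.
have nq : nrm q = 1 / 4 by rewrite nrm_real ger0_norm// divr_ge0.
have ni : nrm ('i%C : R[i]) = 1.
  by rewrite /nrm norm_normc /= expr0n /= expr1n add0r sqrtr1.
have cq : q^* = q by apply: conj_Creal; rewrite complex_real.
have ci : ('i%C : R[i])^* = - 'i%C by apply/eqP; rewrite eq_complex /= oppr0 !eqxx.
have h : 2 * nrm X <= nrm (X - Y) + nrm (X + Y).
  have -> : 2 * nrm X = nrm ((X - Y) + (X + Y)).
    have -> : X - Y + (X + Y) = 2%:R%:C%C * X.
      by rewrite rmorphMn /= rmorph1 addrACA addNr addr0 mulr_natl mulr2n.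
    by rewrite nrmM nrm_real ger0_norm.
  exact: ler_nrmD.
have [h1|h1] := leP (nrm X) (nrm (X - Y)).
  by exists q => //; rewrite cq -mulrBr nrmM nq ler_wpM2l// divr_ge0.
exists ('i%C * q); first by rewrite nrmM ni nq [1 * (1 / 4)]mul1r.
rewrite rmorphM /= cq ci !mulNr -opprD -mulrDr nrmN !nrmM ni nq [1 * (1 / 4)]mul1r.
rewrite ler_wpM2l ?divr_ge0//; lra.
Qed.

Lemma coset_combinationE (s : seq (R[i] * G)) (u : C0 R G) :
  coset_combination m s u = \sum_(p <- s) p.1 * (d p.2 * m) u.
Proof. by rewrite /coset_combination meas_sum. Qed.

Lemma coset_average (u : C0 R G) (h : G) (c : R[i]) :
  (forall k, subgroup_set K k -> u (h * k)%g = c) -> (d h * m) u = c.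
Proof. by move=> uc; rewrite dirac_measE; apply: (haar_const cK hK). Qed.

(** The assumption on [g] keeps the cosets of [s g] and [s g^-1] apart from those of [s]. Tested on
    a suitable function, the first-order part of the Moebius element multiplies the norm by [5/4],
    up to the error from [u]; the remainder loses at most [1/6], and [5/4 - 1/6 = 13/12]. *)
Lemma combination_growth (s : seq (R[i] * G)) (g : G) (e : R) :
  (forall p, p \in s -> N p.2) -> N g ->
  (forall p q, p \in s -> q \in s -> ~ subgroup_set K (p.2^-1 * q.2 * g)%g) ->
  0 < e -> exists2 a : R[i], nrm a = 1 / 4 &
    13 / 12 * nrm (coset_combination m s) - e <=
      nrm (coset_combination m s * mobius a g).
Proof.
move=> sN Ng sg e0; set v := coset_combination m s.
have [u u1 vu] := nrm_meas_adherent v (divr_gt0 e0 (ltr0n R 2)).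
pose f h := (d h * m) u.
have fK h k : subgroup_set K k -> f (h * k)%g = f h.
  by move=> Kk; rewrite /f diracM -mulrA (dirac_haar cK hK Kk).
have f1 h : nrm (f h) <= 1.
  rewrite /f dirac_measE; apply: (haar_le cK hK) => k _.
  by apply: le_trans (le_C0_nrm _ _) u1.
have Kinv x : subgroup_set K x^-1%g -> subgroup_set K x.
  by move=> /subgroupV; rewrite invgK.
pose A h := exists2 p, p \in s & subgroup_set K (p.2^-1 * h)%g.
pose B h := exists2 p, p \in s & subgroup_set K ((p.2 * g)^-1 * h)%g.
(* Cosets of [s g^-1] may coincide with cosets of [s g], where the test function is already
   prescribed. Thus [Y], up to the phase [c], is the resulting value of [v * d g^-1], with [0]
   chosen wherever the function is free. *)
pose psi h := if pselect (B h) then f (h * g^-1)%g else 0.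
pose X := v u; pose Y := \sum_(p <- s) p.1 * psi (p.2 * g^-1)%g.
have [a na aXY] := mobius_parameter X Y.
exists a => //.
set Z := a^* * X - a * Y in aXY.
have [c c1 XZ] := unimodular_align X Z.
(* [A] and [B] are the unions of the cosets of [s] and of [s g]. The test function
   [w] is optimal for [v] on [A] and, up to the phase [c], for [v * d g] on [B]. *)
pose w h := if pselect (A h) then f h else c * psi h.
have AB h : A h -> ~ B h.
  move=> [p ps Kp] [q qs Kq]; apply: (sg p q ps qs).
  have := subgroupM Kp (subgroupV Kq).
  by rewrite invgM invgK -!mulgA mulVKg !mulgA.
have AK h h' : subgroup_set K (h^-1 * h')%g -> A h -> A h'.
  move=> Kh [p ps Kp]; exists p => //; have := subgroupM Kp Kh.
  by rewrite mulgA mulgK.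
have BK h h' : subgroup_set K (h^-1 * h')%g -> B h -> B h'.
  move=> Kh [p ps Kp]; exists p => //; have := subgroupM Kp Kh.
  by rewrite mulgA mulgK.
have Ksym h h' : subgroup_set K (h^-1 * h')%g -> subgroup_set K (h'^-1 * h)%g.
  by move=> /subgroupV; rewrite invgM invgK.
have fK' h h' : subgroup_set K (h^-1 * h')%g -> f h = f h'.
  by move=> /(fK h); rewrite mulVKg.
have psiK h h' : subgroup_set K (h^-1 * h')%g -> psi h = psi h'.
  move=> Kh; rewrite /psi; case: pselect => Bh; case: pselect => Bh' //.
  - apply: fK'; rewrite invgM invgK !mulgA -[(g * h^-1 * h')%g]mulgA.
    by have /normaliser_setP/(_ (h^-1 * h')%g) [+ _] := Ng; exact.
  - by case: Bh'; exact: BK Bh.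
  - by case: Bh; exact: BK (Ksym _ _ Kh) Bh'.
have wK h h' : subgroup_set K (h^-1 * h')%g -> w h = w h'.
  move=> Kh; rewrite /w; case: pselect => Ah; case: pselect => Ah' //.
  - exact: fK'.
  - by case: Ah'; exact: AK Ah.
  - by case: Ah; exact: AK (Ksym _ _ Kh) Ah'.
  - by congr (c * _); exact: psiK.
have w1 h : nrm (w h) <= 1.
  rewrite /w; case: pselect => [?|?]; first exact: f1.
  rewrite nrmM -[leRHS]mulr1; apply: ler_pM; rewrite ?nrm_ge0//.
    by rewrite -lecR -nrmE.
  by rewrite /psi; case: pselect => [?|?]; [exact: f1|rewrite nrm0 ler01].
have [u' u'1 u'w] := interpolation hG lG cK
  ([seq p.2 | p <- s] ++ [seq (p.2 * g)%g | p <- s] ++ [seq (p.2 * g^-1)%g | p <- s])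
  wK w1.
have w_in p : p \in s -> w p.2 = f p.2.
  move=> ps; rewrite /w; case: pselect => // -[]; exists p => //.
  by rewrite mulVg; exact: subgroup1.
have w_r p : p \in s -> w (p.2 * g)%g = c * f p.2.
  move=> ps; have Bp : B (p.2 * g)%g.
    by exists p => //; rewrite mulVg; exact: subgroup1.
  rewrite /w; case: pselect => [/AB//|?].
  by rewrite /psi; case: pselect => // ?; rewrite mulgK.
have w_l p : p \in s -> w (p.2 * g^-1)%g = c * psi (p.2 * g^-1)%g.
  move=> ps; rewrite /w; case: pselect => // -[q qs Kq]; exfalso.
  apply: (sg p q ps qs); have /normaliser_setP Ng' := Ng; apply: (Ng' _).2.
  rewrite !mulgA mulgK; apply: Kinv; rewrite !invgM invgK mulgA.
  by rewrite -mulgA.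
have Ng' := normaliserV Ng.
pose mu := v * (1 + a^* *: d g - a *: d g^-1%g).
(* On [u'] the terms [v], [v * d g] and [v * d g^-1] take the values [X], [c * X] and [c * Y]; [c]
   was chosen to align [Z] with [X]. *)
have muE : mu u' = X + c * Z.
  rewrite /mu mulrBr mulrDr mulr1 !measZr !(coset_combination_dirac cK hK)//.
  rewrite measD measN measD !measZ /v !coset_combinationE !big_map /=.
  have -> : \sum_(p <- s) p.1 * (d p.2 * m) u' = X.
    rewrite /X coset_combinationE; apply: eq_big_seq => p ps; congr (_ * _).
    rewrite -/(f _) -(w_in p ps); apply: coset_average; apply: u'w.
    by rewrite mem_cat map_f.
  have -> : \sum_(p <- s) p.1 * (d (p.2 * g)%g * m) u' = c * X.
    rewrite /X coset_combinationE mulr_sumr; apply: eq_big_seq => p ps.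
    rewrite mulrCA; congr (_ * _); rewrite -/(f _) -(w_r p ps).
    apply: coset_average; apply: u'w.
    by rewrite !mem_cat [X in _ || (X || _)]map_f ?orbT.
  have -> : \sum_(p <- s) p.1 * (d (p.2 * g^-1)%g * m) u' = c * Y.
    rewrite mulr_sumr; apply: eq_big_seq => p ps.
    rewrite mulrCA; congr (_ * _); rewrite -(w_l p ps).
    apply: coset_average; apply: u'w.
    by rewrite !mem_cat [X in _ || (_ || X)]map_f ?orbT.
  by rewrite /Z; ring.
have nmu : 5 / 4 * (nrm v - e / 2) <= nrm mu.
  have : nrm (mu u') <= nrm mu.
    by apply: le_trans (le_nrm_meas _ _) _; rewrite ler_piMr ?nrm_ge0.
  rewrite muE; move: XZ; rewrite !nrmE -rmorphD lecR; move: vu aXY; rewrite -/X; lra.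
have nE := nrm_measM_le (lexx (nrm v)) (mobius_expansion g na).
have : nrm mu <= nrm (v * mobius a g) +
   nrm (v * (mobius a g - (1 + a^* *: d g - a *: d g^-1%g))).
  rewrite -[X in _ + X]nrmN; apply: le_trans (ler_nrmD _ _).
  by rewrite mulrBr opprB addrC subrK.
move: nmu nE e0; lra.
Qed.

End Growth.

(** * Strict inclusion of [Gamma] and unboundedness of the component *)

Section Unbounded.
Variables (R : realType) (G : topGroupType) (K : subgroup G).
Variable mK : measure_algebra R G.
Hypothesis hG : hausdorff_space G.
Hypothesis lG : locally_compact [set: G].
Hypothesis cK : compact (subgroup_set K).
Hypothesis hK : normalised_haar K mK.
Local Notation m := mK.
Local Notation M := (measure_algebra R G).
Local Notation d := (@dirac_measure R G).
Local Notation N := (normaliser_set K).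

Lemma haar_local_unitary : local_unitary m m.
Proof. by rewrite /local_unitary /= (star_haar cK hK) convE (haarM cK hK). Qed.

Lemma nrm_haar : nrm m = 1.
Proof.
apply/le_anti; rewrite (nrm_haar_le1 cK hK) /=.
have [//||u u1 uE] := @interpolation R G K hG lG cK (fun=> 1) [:: 1%g].
  by move=> h; rewrite nrm1.
have mu1 : m u = 1.
  by apply: (haar_const cK hK) => k Kk; rewrite -[k]mul1g uE ?mem_head.
by rewrite -[leLHS](nrm1 R) -mu1; apply: le_trans (le_nrm_meas _ _) _;
  rewrite ler_piMr ?nrm_ge0.
Qed.

Lemma Gamma_proper : subgroup_set K `<` N -> Gamma_group K m `<` local_unitary m.
Proof.
move=> [KN /existsNP[g /not_implyP[Ng nKg]]].
split; first exact: (Gamma_sub_local_unitary cK hK).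
have sN (p : R[i] * G) : p \in [:: (1, 1%g)] -> N p.2.
  by rewrite inE => /eqP ->; exact: normaliser1.
(* The single coset [K], moved off itself by [g]. The error [1/24] leaves norm at least
   [13/12 - 1/24 = 25/24]. *)
have [||a na] := @combination_growth R G K m hG lG cK hK [:: (1, 1%g)] g (1 / 24) sN Ng.
- move=> p q; rewrite !inE => /eqP -> /eqP -> /=.
  by rewrite invg1 !mul1g.
- by rewrite divr_gt0.
rewrite /coset_combination big_seq1 scale1r dirac1 mul1r nrm_haar => h sub.
have Ng' := normaliserV Ng.
have a1 : nrm a < 1 by rewrite na; lra.
have U := local_unitary_mobius a1 (dirac_haar_comm cK hK Ng) (dirac_haar_comm cK hK Ng')
   haar_local_unitary.
have := Gamma_nrm_le1 cK hK (sub _ U); lra.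
Qed.

(** Infinitude of [N_G(K)/K], phrased so that it directly yields an element avoiding finitely many
    given cosets. *)
Hypothesis infinite_quotient : forall s : seq G, (forall h, h \in s -> N h) ->
  exists2 g, N g & forall h, h \in s -> ~ subgroup_set K (h^-1 * g)%g.

Lemma approximable_growth v : approximable K m v -> 1 <= nrm v ->
  exists a g, [/\ nrm a = 1 / 4, N g & nrm v + 1 / 32 <= nrm (v * mobius a g)].
Proof.
move=> hv v1; have e0 : (0 : R) < 1 / 200 by rewrite divr_gt0.
have [s sN vs] := hv _ e0.
have [|g Ng sg] := @infinite_quotient [seq (q.2^-1 * p.2)%g | p <- s, q <- s].
  move=> h /allpairsP[[p q] [/= ps qs ->]].
  by apply: normaliserM; [apply: normaliserV; exact: sN|exact: sN].
have [||a na h] := @combination_growth R G K m hG lG cK hK s g (1 / 200) sN Ng.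
- move=> p q ps qs Kpq; apply: (sg (q.2^-1 * p.2)%g).
    by apply/allpairsP; exists (p, q).
  by rewrite invgM invgK.
- by [].
exists a, g; split=> //.
have h1 : nrm (mobius a g) <= 2.
  rewrite -(subrK (1 + a^* *: d g - a *: d g^-1%g) (mobius a g)).
  have := mobius_expansion g na.
  have := nrm_Zdirac a^* g; rewrite nrm_conj na; have := nrm_Zdirac a g^-1%g; rewrite na.
  have := ler_nrmD (1 + a^* *: d g) (- (a *: d g^-1%g)); rewrite nrmN.
  have := ler_nrmD (1 : M) (a^* *: d g); have := @nrm_dirac_le1 R G 1%g.
  rewrite dirac1; set E := mobius a g - _.
  have := ler_nrmD E (1 + a^* *: d g - a *: d g^-1%g).
  by move: (nrm _) (nrm _) (nrm _) (nrm _) (nrm _) (nrm _) => *; lra.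
have h2 := nrm_measM_le vs h1.
have h3 : nrm (coset_combination m s * mobius a g) <=
    nrm (v * mobius a g) + nrm ((v - coset_combination m s) * mobius a g).
  rewrite -[X in _ + X]nrmN; apply: le_trans (ler_nrmD _ _).
  by rewrite mulrBl opprB addrC subrK.
have h4 : nrm v <= nrm (coset_combination m s) + nrm (v - coset_combination m s).
  by apply: le_trans (ler_nrmD _ _); rewrite addrC subrK.
move: h h2 h3 h4 vs v1; clear.
move: (nrm _) (nrm _) (nrm _) (nrm _) (nrm _) => *; lra.
Qed.

Lemma component_growth n : exists v, [/\ approximable K m v,
  connected_component (local_unitary m) m v & 1 + n%:R / 32 <= nrm v].
Proof.
elim: n => [|n [v [hv mv vn]]].
  exists m; split; first exact: approximable_haar.
    exact/connected_component_refl/haar_local_unitary.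
  by rewrite mul0r addr0 nrm_haar.
have [|a [g [na Ng vg]]] := approximable_growth hv.
  by apply: le_trans vn; rewrite lerDl divr_ge0.
have Ng' := normaliserV Ng.
exists (v * mobius a g); split.
- by apply: (approximable_mobius cK hK) => //; rewrite na; lra.
- by apply: connected_mobius => //; [rewrite na|exact: (dirac_haar_comm cK hK Ng)|
    exact: (dirac_haar_comm cK hK Ng')].
- rewrite -natr1 mulrDl addrA; apply: le_trans vg; lra.
Qed.

Lemma component_unbounded :
  ~ bounded_set (connected_component (local_unitary m) m).
Proof.
move=> [c [cr hc]].
have c1 : c < c + 1 by rewrite ltrDl.
(* Each step gains [1/32], so more than [32] times the supposed bound [c + 1] steps contradict
   it. *)
pose x : R := 32 * complex.Re (c + 1).
have [v [_ mv vn]] := component_growth (Num.bound `|x|).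
have : `|v| <= c + 1 := hc _ c1 v mv; rewrite nrmE lecE => /andP[_ vc].
set k : R := _%:R in vn; have kx : `|x| < k := archi_boundP (normr_ge0 x).
have xv : 32 * nrm v <= x by rewrite /x ler_wpM2l.
by move: vn kx xv (ler_norm x); clear; move: (nrm v) `|x| => *; lra.
Qed.
End Unbounded.

(** * Finite discrete groups are Hermitian *)

(** A Hermitian matrix has real eigenvalues: for a left eigenvector [v], the form [S = z * T] and
    the squared length [T] of [v] are both real, and [T] is nonzero. *)
Lemma hermitian_mx_unit (C : numClosedFieldType) (n : nat) (F : 'M[C]_n) (z : C) :
  (forall i j, (F i j)^* = F j i) -> z \isn't Num.real ->
  z%:M - F \in unitmx.
Proof.
move=> hF nz; rewrite unitmxE unitfE; apply/negP => /det0P[v v0 vz].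
have vF j : \sum_i v 0 i * F i j = z * v 0 j.
  move: vz; rewrite mulmxBr mul_mx_scalar => /eqP; rewrite subr_eq0 => /eqP.
  by move=> /matrixP/(_ 0 j); rewrite !mxE.
pose T := \sum_j v 0 j * (v 0 j)^*.
pose S := \sum_j (\sum_i v 0 i * F i j) * (v 0 j)^*.
have ST : S = z * T.
  by rewrite /S mulr_sumr; apply: eq_bigr => j _; rewrite vF mulrA.
have T0 : T != 0.
  apply: contraNneq v0 => T0; apply/eqP/rowP => j; rewrite mxE.
  have := @psumr_eq0P C _ xpredT (fun j => v 0 j * (v 0 j)^*) _ T0 j erefl.
  move=> h; apply/eqP; rewrite -normr_eq0 -sqrf_eq0 normCK; apply/eqP/h => i _.
  exact: mul_conjC_ge0.
have cT : T^* = T.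
  by rewrite rmorph_sum; apply: eq_bigr => j _; rewrite rmorphM /= conjCK mulrC.
have cS : S^* = S.
  rewrite rmorph_sum /= /S.
  under [RHS]eq_bigr do rewrite mulr_suml.
  rewrite [RHS]exchange_big /=; apply: eq_bigr => j _.
  rewrite rmorphM rmorph_sum /= conjCK mulrC mulr_sumr; apply: eq_bigr => i _.
  by rewrite rmorphM /= hF; ring.
move/negP: nz; apply; rewrite CrealE; apply/eqP.
by move: cS; rewrite ST rmorphM /= cT => /(mulIf T0).
Qed.

Section FiniteGroup.
Variables (R : realType) (H : topGroupType) (n : nat).
Variables (e : 'I_n -> H) (r : H -> 'I_n).
Hypotheses (er : cancel e r) (re : cancel r e).
Hypothesis discrete : forall U : set H, open U.
Local Notation M := (measure_algebra R H).
Local Notation d := (@dirac_measure R H).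

Lemma discrete_continuous (f : H -> R[i]) : continuous f.
Proof. by apply/continuousP. Qed.

Lemma finite_group_compact : compact [set: H].
Proof.
apply: finite_compact; apply: (@sub_finite_set _ _ (e @` setT)).
  by move=> x _; exists (r x); rewrite ?re.
exact/finite_image/finite_finset.
Qed.

Definition point_C0 (x : H) : C0 R H :=
  MkC0 (compact_C0 finite_group_compact
    (@discrete_continuous (fun y => (y == x)%:R))).

Lemma C0_point_sum (u : C0 R H) : u = \sum_i u (e i) *: point_C0 (e i).
Proof.
apply: C0P => x; rewrite C0_sumZE (bigD1 (r x)) //= big1 ?addr0 => [|i ix].
  by rewrite re eqxx mulr1.
rewrite (_ : (x == e i) = false) ?mulr0//.
by apply/negbTE; apply: contra ix => /eqP ->; rewrite er.
Qed.

Lemma measE (mu : M) (u : C0 R H) : mu u = \sum_i u (e i) * mu (point_C0 (e i)).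
Proof. by rewrite {1}(C0_point_sum u) dual_sumZ. Qed.

Lemma measP (mu nu : M) :
  (forall i, mu (point_C0 (e i)) = nu (point_C0 (e i))) -> mu = nu.
Proof.
move=> h; apply: dualP => u; rewrite !measE.
by apply: eq_bigr => i _; rewrite h.
Qed.

Lemma convM_point (mu nu : M) h : (mu * nu) (point_C0 h) =
  \sum_i mu (point_C0 (h * (e i)^-1)%g) * nu (point_C0 (e i)).
Proof.
rewrite -[LHS]/(mu (slice nu (point_C0 h))).
have -> : slice nu (point_C0 h) =
   \sum_i nu (point_C0 (e i)) *: point_C0 (h * (e i)^-1)%g.
  apply: C0P => s; rewrite C0_sumZE /= measE; apply: eq_bigr => i _ /=.
  rewrite mulrC; congr (_ * _%:R); congr nat_of_bool.
  by apply/eqP/eqP => [<-|->]; rewrite ?mulgK ?mulgVK.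
by rewrite dual_sumZ; apply: eq_bigr => i _; rewrite mulrC.
Qed.

(** In the basis of point masses, left convolution by [f] is the matrix [F], which is Hermitian
    because [star f = f]. Inverting [z%:M - F] solves for the coefficients [c] of [g]. *)
Lemma right_inverse_finite (f : M) (z : R[i]) : star f = f -> z \isn't Num.real ->
  exists g : M, (z *: d 1%g - f) * g = d 1%g.
Proof.
move=> sf nz; pose F : 'M[R[i]]_n := \matrix_(i, j) f (point_C0 (e i * (e j)^-1)%g).
have hF i j : (F i j)^* = F j i.
  rewrite !mxE -{2}sf -[RHS]/((f (flip _))^*); congr ((f _)^*).
  apply: C0P => s; rewrite /= conjC_nat; congr (_%:R); congr nat_of_bool.
  apply/eqP/eqP => [->|/(congr1 (fun x => x^-1)%g)]; rewrite invgM invgK//.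
  by rewrite invgK.
have U := hermitian_mx_unit hF nz.
pose A := z%:M - F; pose b : 'cV[R[i]]_n := \col_i (e i == 1%g)%:R.
pose c := invmx A *m b.
have Ac i : \sum_j A i j * c j 0 = (e i == 1%g)%:R.
  have : (A *m c) i 0 = b i 0 by rewrite mulKVmx.
  by rewrite !mxE.
pose g : M := \sum_j c j 0 *: d (e j).
have gE j : g (point_C0 (e j)) = c j 0.
  rewrite /g meas_sum (bigD1 j) // big1 => [|k kj].
    by rewrite measZ [LHS]addr0 -[d _ _]/((e j == e j)%:R) eqxx mulr1.
  rewrite measZ -[d _ _]/((e k == e j)%:R) (_ : (e k == e j) = false) ?mulr0//.
  by apply/negbTE; apply: contra kj => /eqP/(can_inj er) ->.
exists g; apply: measP => i.
rewrite convM_point -[RHS]/((1%g == e i)%:R) [1%g == _]eq_sym -Ac.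
apply: eq_bigr => j _; rewrite gE; congr (_ * _).
rewrite measD measN measZ /= !mxE; congr (_ - _).
rewrite mulr_natr; congr (_ *+ nat_of_bool _).
apply/eqP/eqP => [/(congr1 (fun x => x * e j)%g)|->]; last by rewrite mulgV.
by rewrite mul1g mulgVK => /(can_inj er).
Qed.

(** By translation invariance [lam] is a nonzero multiple of counting measure, so every measure has
    a density: its point masses divided by the common mass of a point. *)
Lemma all_L1 lam (nu : M) : is_haar lam -> L1 lam nu.
Proof.
move=> lamP; apply: subset_closure.
have cs (f : H -> R[i]) : compactly_supported f.
  by apply: compact_supported; [exact: finite_group_compact|exact: discrete_continuous].
have lam_sum (I : Type) (s : seq I) (c : I -> R[i]) (f : I -> H -> R[i]) :
    lam (fun x => \sum_(i <- s) c i * f i x) = \sum_(i <- s) c i * lam (f i).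
  elim: s => [|i s IH].
    rewrite big_nil (_ : (fun x => _) = (fun=> -1 * 0 + 0)); last first.
      by apply/funext => x; rewrite big_nil mulr0 addr0.
    by rewrite (haar_linear lamP)// mulN1r addNr.
  rewrite big_cons -IH -(haar_linear lamP)//; congr lam; apply/funext => x.
  by rewrite big_cons.
have lamp h : lam (point_C0 h) = lam (point_C0 1%g).
  rewrite -(haar_translate lamP h)//; congr lam; apply/funext => x /=.
  congr (_%:R); congr nat_of_bool.
  by apply/eqP/eqP => [|->]; [rewrite -{2}[h]mulg1 => /mulgI|rewrite mulg1].
have lamE (f : H -> R[i]) : lam f = (\sum_i f (e i)) * lam (point_C0 1%g).
  pose u : C0 R H := MkC0 (compact_C0 finite_group_compact (@discrete_continuous f)).
  rewrite -[f]/(u : H -> R[i]) {1}(C0_point_sum u).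
  have -> : C0_fun (\sum_i u (e i) *: point_C0 (e i)) =
     (fun x => \sum_i u (e i) * point_C0 (e i) x).
    by apply/funext => x; rewrite C0_sumZE.
  by rewrite lam_sum mulr_suml; apply: eq_bigr => i _; rewrite lamp.
have l0 : lam (point_C0 1%g) != 0.
  have [f _] := haar_neq0 lamP; apply: contraNneq => l0.
  by rewrite lamE l0 mulr0.
exists (fun x => nu (point_C0 x) / lam (point_C0 1%g)) => // u.
rewrite measE lamE mulr_suml; apply: eq_bigr => i _.
by rewrite mulrAC divfK// mulrC.
Qed.

Lemma finite_hermitian : hermitian_group R H.
Proof.
move=> lam lamP f _ sf z /= nz; apply: contrapT => /negP rz; apply: nz.
have [g bg] := right_inverse_finite sf rz.
(* Applying [star] to a right inverse at the conjugate [z^*] gives a left inverse at [z], which must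
   agree with the right inverse [g]. *)
have rz' : z^* \isn't Num.real.
  by apply: contra rz; rewrite !CrealE conjCK eq_sym.
have [g' bg'] := right_inverse_finite sf rz'.
have gb : star g' * (z *: d 1%g - f) = 1.
  have := congr1 (@star R H) bg'.
  rewrite (star_convM finite_group_compact) starD starN starZ conjCK sf.
  by rewrite star_dirac invg1.
have gg : star g' = g by rewrite -[LHS]mulr1 -[1]bg mulrA gb mul1r.
exists g; first by exists 0, g; split; [exact: all_L1|rewrite scale0r add0r].
by split=> //; rewrite convE -gg.
Qed.

End FiniteGroup.

(** * Finite quotients *)

Section FiniteQuotient.
Variables (G : topGroupType) (K : subgroup G).
Hypothesis hG : hausdorff_space G.
Hypothesis cK : compact (subgroup_set K).
Variable s : seq G.
Hypothesis sN : forall h, h \in s -> normaliser_set K h.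
Hypothesis coverN : forall g, normaliser_set K g ->
  exists2 h, h \in s & subgroup_set K (h^-1 * g)%g.
Local Notation Nt := (subgroup_type (normaliser K)).
Local Notation Q := (normaliser_quotient K).

Lemma closed_cosets (l : seq G) :
  closed [set y : Nt | exists2 h, h \in l & subgroup_set K (h^-1 * subg_val y)%g].
Proof.
elim: l => [|h l IH].
  suff -> : [set y : Nt | exists2 h, h \in [::] & subgroup_set K (h^-1 * subg_val y)%g] = set0.
    exact: closed0.
  by apply/seteqP; split=> // y [].
have -> : [set y : Nt | exists2 h', h' \in h :: l & subgroup_set K (h'^-1 * subg_val y)%g] =
   (fun y : Nt => h^-1 * subg_val y)%g @^-1` K `|`
   [set y : Nt | exists2 h', h' \in l & subgroup_set K (h'^-1 * subg_val y)%g].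
  apply/seteqP; split=> y.
    move=> [h']; rewrite inE => /orP[/eqP->|h'l] Ky; first by left.
    by right; exists h'.
  move=> [Ky|[h' h'l Ky]]; first by exists h; rewrite ?mem_head.
  by exists h' => //; rewrite inE h'l orbT.
apply: closedU => //; apply: closed_comp; last exact: compact_closed cK.
move=> y _; apply: (continuous_mulg (f := fun=> h^-1%g)); first exact: cst_continuousg.
exact: subg_val_continuous.
Qed.

(** The complement of the preimage of [U] is a union of finitely many cosets of [K], each closed
    because [K] is compact in a Hausdorff group. The predicate [P] selects the representatives whose
    class lies outside [U]. *)
Lemma quotient_discrete (U : set Q) : open U.
Proof.
suff : open (@coset_proj G K @^-1` U) by [].
rewrite -[X in open X]setCK openC.
pose P h := `[< ~ exists2 x : Nt, subg_val x = h & U (coset_proj x) >].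
have -> : ~` (@coset_proj G K @^-1` U) =
   [set y : Nt | exists2 h, h \in [seq h <- s | P h] & subgroup_set K (h^-1 * subg_val y)%g].
  apply/seteqP; split=> y /=.
    move=> nUy; have [h hs Kh] := coverN (subg_valP y).
    exists h => //; rewrite mem_filter hs andbT; apply/asboolP => -[x xh Ux].
    apply: nUy; rewrite (_ : coset_proj y = coset_proj x)//; apply/esym.
    by apply/coset_proj_eq/same_cosetP; move: Kh; rewrite -xh.
  move=> [h]; rewrite mem_filter => /andP[/asboolP Ph hs] Kh Uy; apply: Ph.
  exists (subg_mk (H := normaliser K) (sN hs)) => //.
  rewrite (_ : coset_proj _ = coset_proj y)//.
  exact/coset_proj_eq/same_cosetP.
exact: closed_cosets.
Qed.

Lemma subgroup_discrete (A : subgroup Q) (U : set (subgroup_type A)) : open U.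
Proof.
exists (@subg_val Q A @` U); first exact: quotient_discrete.
apply/seteqP; split=> x /=; last by exists x.
by move=> [y Uy /subg_val_inj <-].
Qed.

Lemma quotient_list : exists l : seq Q, forall q : Q, q \in l.
Proof.
pose f (h : G) : Q := if pselect (normaliser_set K h) is left Nh
  then coset_proj (subg_mk (H := normaliser K) Nh) else 1%g.
exists [seq f h | h <- s] => q; have [x <-] := coset_projP q.
have [h hs Kh] := coverN (subg_valP x).
apply/mapP; exists h => //; rewrite /f; case: pselect => [Nh|]; last by case; exact: sN.
by apply/esym/coset_proj_eq/same_cosetP.
Qed.

Lemma subgroup_hermitian (R : realType) (A : subgroup Q) :
  hermitian_group R (subgroup_type A).
Proof.
have [l lP] := quotient_list.
pose T := subgroup_type A.
have [k kP] : exists k : seq T, forall x : T, x \in k.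
  exists (pmap (fun q : Q => if pselect (subgroup_set A q) is left Aq
    then Some (subg_mk Aq) else None) l) => x.
  rewrite mem_pmap; apply/mapP; exists (subg_val x) => //.
  case: pselect => [Aq|]; last by case; exact: subg_valP.
  by congr Some; apply: subg_val_inj.
(* Without duplicates, [nth] and [index] on the list are mutually inverse and enumerate the group by
   ordinals. *)
have sz x : (index x (undup k) < size (undup k))%N by rewrite index_mem mem_undup.
apply: (@finite_hermitian R T (size (undup k)) (fun i => nth 1%g (undup k) i)
  (fun x => Ordinal (sz x))) => [i|x|U].
- by apply: val_inj; rewrite /= index_uniq ?undup_uniq.
- by rewrite /= nth_index// mem_undup.
- exact: subgroup_discrete.
Qed.

End FiniteQuotient.

Theorem proposition3p6 (R : realType) (G : topGroupType) (K : subgroup G)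
    (mK : measure_algebra R G) :
  hausdorff_space G -> locally_compact [set: G] ->
  compact (subgroup_set K) -> normalised_haar K mK ->
  (subgroup_set K `<` normaliser_set K ->
    Gamma_group K mK `<` local_unitary mK) /\
  ((exists A : subgroup (normaliser_quotient K),
      [/\ closed (subgroup_set A), abelian_subgroup A &
          ~ discrete_subgroup A]) \/
   (exists H : subgroup (normaliser_quotient K),
      closed (subgroup_set H) /\ ~ hermitian_group R (subgroup_type H)) ->
    ~ bounded_set (connected_component (local_unitary mK) mK)).
Proof.
move=> hG lG cK hK; split; first exact: Gamma_proper.
move=> AH; apply: (component_unbounded hG lG cK hK) => s sN.
(* A list [s] whose cosets cannot be avoided represents all of [N_G(K)/K]; the quotient would be
   finite, contrary to either alternative. *)
apply: contrapT => no_g.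
have cover g : normaliser_set K g ->
    exists2 h, h \in s & subgroup_set K (h^-1 * g)%g.
  move=> Ng; apply: contrapT => no_h; apply: no_g; exists g => // h hs Kh.
  by apply: no_h; exists h.
case: AH => [[A [_ _ nA]]|[H [_ nH]]].
- by apply: nA => x; exact: (subgroup_discrete hG cK sN cover).
- by apply: nH; exact: (subgroup_hermitian hG cK sN cover).
Qed.
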